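(* A matrix $R\in M_2\otimes M_2\cong M_4$ is a (unitary) R-matrix of dimension $2$, i.e. $R\in\mathcal{R}(2)$, if and only if there exist a unitary $u\in M_2$ and $i\in\{1,2,3,4\}$ such that $R=(u\otimes u)R_i(u\otimes u)^*$, where $R_1,\dots,R_4$ are (for some choice of parameters) of the form $$R_1=q\cdot1,\qquad R_2=\begin{pmatrix}p&0&0&0\\ 0&0&q&0\\ 0&r&0&0\\ 0&0&0&s\end{pmatrix},\qquad R_3=\begin{pmatrix}0&0&0&p\\ 0&q&0&0\\ 0&0&q&0\\ {r}&0&0&0\end{pmatrix},\qquad R_4=\frac{q}{\sqrt2}\begin{pmatrix}1&1&0&0\\ -1&1&0&0\\ 0&0&1&-1\\ 0&0&1&1\end{pmatrix},$$ and all parameters $p,q,r,s$ appearing in the representatives are complex numbers of modulus $1$.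
   Context: $\mathcal{R}(2)$ is the set of unitaries $R$ on $\mathbb{C}^2\otimes\mathbb{C}^2$ satisfying the Yang-Baxter equation $(R\otimes1)(1\otimes R)(R\otimes1)=(1\otimes R)(R\otimes1)(1\otimes R)$ on $\mathbb{C}^2\otimes\mathbb{C}^2\otimes\mathbb{C}^2$. Matrices in $M_4$ are written with respect to the ordered basis $e_1\otimes e_1,\ e_1\otimes e_2,\ e_2\otimes e_1,\ e_2\otimes e_2$ of $\mathbb{C}^2\otimes\mathbb{C}^2$, where $e_1,e_2$ is the standard basis of $\mathbb{C}^2$. *)

(* Defs.v *)
From HB Require Import structures.
From mathcomp Require Import all_boot all_order all_algebra.
From mathcomp Require Import reals.
From mathcomp Require Import complex.
(* Not imported: its notation "A ^t k" clashes with the conjugate transpose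
   "M ^t*" of sesquilinear_scope. *)
From mathcomp.real_closed Require mxtens.

Set Implicit Arguments.
Unset Strict Implicit.
Unset Printing Implicit Defensive.

Import Order.TTheory GRing.Theory Num.Theory.
Local Open Scope ring_scope.
Local Open Scope sesquilinear_scope.

(* [tensmx] orders the product basis as e_i (x) e_j |-> i * n + j, i.e. as
   e_1(x)e_1, e_1(x)e_2, e_2(x)e_1, e_2(x)e_2 when n = 2. *)
Notation "A *t B" := (mxtens.tensmx A B)
  (at level 40, left associativity, format "A  *t  B") : ring_scope.

Section YangBaxter.
Variables (C : numClosedFieldType) (d : nat).

Definition leg12 (A : 'M[C]_(d * d)) : 'M[C]_(d * d * d) := A *t (1%:M : 'M_d).

(* The cast identifies V (x) (V (x) V) with (V (x) V) (x) V; it preserves the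
   numbering of the basis. *)
Definition leg23 (A : 'M[C]_(d * d)) : 'M[C]_(d * d * d) :=
  castmx (mulnA d d d, mulnA d d d) ((1%:M : 'M_d) *t A).

Definition yang_baxter (A : 'M[C]_(d * d)) : Prop :=
  leg12 A *m leg23 A *m leg12 A = leg23 A *m leg12 A *m leg23 A.

Definition unitary_Rmatrix (A : 'M[C]_(d * d)) : Prop :=
  A \is unitarymx /\ yang_baxter A.

End YangBaxter.

Section Representatives.
Variable C : numClosedFieldType.
Implicit Types p q r s : C.

Definition mx4 (rows : seq (seq C)) : 'M[C]_(2 * 2) :=
  \matrix_(i, j) nth 0 (nth [::] rows i) j.

Definition R1 q : 'M[C]_(2 * 2) := q *: 1%:M.

Definition R2 p q r s : 'M[C]_(2 * 2) :=
  mx4 [:: [:: p; 0; 0; 0];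
          [:: 0; 0; q; 0];
          [:: 0; r; 0; 0];
          [:: 0; 0; 0; s]].

Definition R3 p q r : 'M[C]_(2 * 2) :=
  mx4 [:: [:: 0; 0; 0; p];
          [:: 0; q; 0; 0];
          [:: 0; 0; q; 0];
          [:: r; 0; 0; 0]].

Definition R4 q : 'M[C]_(2 * 2) :=
  (q / sqrtC 2) *:
  mx4 [:: [::  1; 1; 0;  0];
          [:: -1; 1; 0;  0];
          [::  0; 0; 1; -1];
          [::  0; 0; 1;  1]].

Variant representative : 'M[C]_(2 * 2) -> Prop :=
| Representative1 q of `|q| = 1 : representative (R1 q)
| Representative2 p q r s of `|p| = 1 & `|q| = 1 & `|r| = 1 & `|s| = 1 :
    representative (R2 p q r s)
| Representative3 p q r of `|p| = 1 & `|q| = 1 & `|r| = 1 :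
    representative (R3 p q r)
| Representative4 q of `|q| = 1 : representative (R4 q).

End Representatives.

(* Main.v *)
Require Import Defs.
From mathcomp Require Import all_boot all_order all_algebra.
From mathcomp Require Import reals.
From mathcomp Require Import complex.
From mathcomp Require Import ring lra.

Set Implicit Arguments.
Unset Strict Implicit.
Unset Printing Implicit Defensive.

Import Order.TTheory GRing.Theory Num.Theory.
Local Open Scope ring_scope.
Local Open Scope sesquilinear_scope.

(** Conjugation by u (x) u preserves unitarity and the Yang-Baxter equation,
    so one direction of the classification is a check on the four families.
    In the other direction the unitary freedom u is spent in two ways.

    Partial traces.  Let T be the partial trace of A over the second factor.
    Tracing A12 A23 A12^* = A23^* A12 A23 shows that A (1 (x) T) A^* and
    T (x) 1 have the same Hilbert-Schmidt norm and that their inner product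
    equals its square, so that they coincide (ptr2_swap).  Together with the
    same fact for A^* this makes T normal.  If T is not scalar, an eigenbasis
    of T turns the intertwining relation into vanishing of matrix entries, and
    only the family R2 survives; exchanging the two tensor factors treats the
    other partial trace in the same way (ptr_nonscalar_classified).

    The Pauli form.  If both partial traces are scalar, then
      A = t + sum_ij c_ij (sigma_i (x) sigma_j)
    for a complex 3 x 3 matrix c, on which u acts as c |-> O c O^T through a
    rotation O.  With K the cofactor matrix of c, some coefficients of the
    Yang-Baxter equation are
      2 c^T c c - tr(c^T c) c = t^2 c - 2 t K     and     K c = c K,
    while unitarity makes c c^* and c^* c real.  There are three cases.
    - K = 0.  Then c vanishes, which gives R1, or c = x y^T with x real up to
      a phase.  Rotating x to the third axis gives R4 (row3_classified).
    - K <> 0 and det c = 0.  Then c has a real null vector; after rotating it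
      to the third axis, t = 0 follows, and the remaining 2 x 2 block
      contradicts unitarity (kernel_e3_rank1).
    - det c <> 0.  Then N = c^T c = c c^T satisfies a quadratic equation with
      the root t^2, and c and c^T share a real eigenvector with eigenvalue
      mu = t or mu = - t (gram_axis).  Rotating it to the third axis makes c
      block diagonal with a conformal 2 x 2 block; mu = t gives R2 and
      mu = - t gives R3 (block_representative). *)

(** * Tensor products and matrix units *)

Notation idx x y := (mxtens.mxtens_index (x, y)).

Section TensorProduct.
Variable C : comPzRingType.

Lemma eq_tensmx m n p q (A B : 'M[C]_(m * n, p * q)) :
  (forall x y z t, A (idx x y) (idx z t) = B (idx x y) (idx z t)) -> A = B.
Proof.
move=> AB; apply/matrixP=> i j.
by case: (mxtens.mxtens_indexP i) => x y; case: (mxtens.mxtens_indexP j).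
Qed.

Lemma sum_tens m n (F : 'I_(m * n) -> C) :
  \sum_k F k = \sum_i \sum_j F (idx i j).
Proof.
rewrite pair_big (reindex (@mxtens.mxtens_index m n)).
  by apply: eq_bigr => -[i j].
apply: onW_bij.
by exists (@mxtens.mxtens_unindex m n);
  [exact: mxtens.mxtens_indexK | exact: mxtens.mxtens_unindexK].
Qed.

Lemma tensmx11 m n : 1%:M *t 1%:M = 1%:M :> 'M[C]_(m * n).
Proof.
apply: eq_tensmx => x y z t.
rewrite mxtens.tensmxE !mxE -natrM mulnb; congr (_ (nat_of_bool _)).
by rewrite (can_eq (@mxtens.mxtens_indexK m n)).
Qed.

Lemma tensmxA m (A B D : 'M[C]_m) :
  castmx (mulnA m m m, mulnA m m m) (A *t (B *t D)) = A *t B *t D.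
Proof.
apply: eq_tensmx => i z k z'.
case: (mxtens.mxtens_indexP i) => x y; case: (mxtens.mxtens_indexP k) => x' y'.
have cE (u v w : 'I_m) :
    cast_ord (esym (mulnA m m m)) (idx (idx u v) w) = idx u (idx v w).
  by apply: val_inj; rewrite /= mulnDl addnA mulnA.
by rewrite castmxE !cE !mxtens.tensmxE mulrA.
Qed.

End TensorProduct.

(** * Operators on two and three tensor factors *)

Section Legs.
Variables (C : numClosedFieldType) (d : nat).
Implicit Types (A X Y : 'M[C]_(d * d)) (B u : 'M[C]_d).

Lemma leg12E A x y z x' y' z' :
  leg12 A (idx (idx x y) z) (idx (idx x' y') z')
  = A (idx x y) (idx x' y') * (z == z')%:R.
Proof. by rewrite /leg12 mxtens.tensmxE mxE. Qed.

Lemma leg23E A x y z x' y' z' :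
  leg23 A (idx (idx x y) z) (idx (idx x' y') z')
  = (x == x')%:R * A (idx y z) (idx y' z').
Proof.
have cE (u v w : 'I_d) :
    cast_ord (esym (mulnA d d d)) (idx (idx u v) w) = idx u (idx v w).
  by apply: val_inj; rewrite /= mulnDl addnA mulnA.
by rewrite /leg23 castmxE !cE mxtens.tensmxE mxE.
Qed.

Lemma leg12M X Y : leg12 (X *m Y) = leg12 X *m leg12 Y.
Proof. by rewrite /leg12 mxtens.tensmx_mul mulmx1. Qed.

Lemma castmxM n n' (e : n = n') (X Y : 'M[C]_n) :
  castmx (e, e) (X *m Y) = castmx (e, e) X *m castmx (e, e) Y.
Proof. by case: n' / e. Qed.

Lemma castmx1 n n' (e : n = n') : castmx (e, e) 1%:M = 1%:M :> 'M[C]_n'.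
Proof. by case: n' / e. Qed.

Lemma leg23M X Y : leg23 (X *m Y) = leg23 X *m leg23 Y.
Proof. by rewrite /leg23 -castmxM mxtens.tensmx_mul mulmx1. Qed.

Lemma leg12_1 : leg12 (1%:M : 'M[C]_(d * d)) = 1%:M.
Proof. exact: tensmx11. Qed.

Lemma leg23_1 : leg23 (1%:M : 'M[C]_(d * d)) = 1%:M.
Proof. by rewrite /leg23 tensmx11 castmx1. Qed.

Lemma adj_tens m n p q (X : 'M[C]_(m, n)) (Y : 'M[C]_(p, q)) :
  (X *t Y)^t* = X^t* *t Y^t*.
Proof. by rewrite mxtens.trmx_tens mxtens.map_mxT. Qed.

Lemma adjCM m n p (X : 'M[C]_(m, n)) (Y : 'M[C]_(n, p)) :
  (X *m Y)^t* = Y^t* *m X^t*.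
Proof. by rewrite trmx_mul map_mxM. Qed.

Lemma adjC1 n : (1%:M : 'M[C]_n)^t* = 1%:M.
Proof. by rewrite trmx1 map_mx1. Qed.

Lemma adj_leg12 A : (leg12 A)^t* = leg12 (A^t*).
Proof. by rewrite /leg12 adj_tens adjC1. Qed.

Lemma adj_castmx n n' (e : n = n') (X : 'M[C]_n) :
  (castmx (e, e) X)^t* = castmx (e, e) (X^t*).
Proof. by case: n' / e. Qed.

Lemma adj_leg23 A : (leg23 A)^t* = leg23 (A^t*).
Proof. by rewrite /leg23 adj_castmx adj_tens adjC1. Qed.

Lemma unitarymxK n (u : 'M[C]_n) : u \is unitarymx -> u^t* *m u = 1%:M.
Proof. by move/unitarymxP/mulmx1C. Qed.

Lemma tensmx_unitary u : u \is unitarymx -> u *t u \is unitarymx.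
Proof.
move/unitarymxP => uu; apply/unitarymxP.
by rewrite adj_tens mxtens.tensmx_mul uu tensmx11.
Qed.

Definition local_conj u A : 'M[C]_(d * d) := (u *t u) *m A *m (u *t u)^t*.

Lemma leg12_conj u A : u \is unitarymx ->
  leg12 (local_conj u A)
  = (u *t u *t u) *m leg12 A *m (u *t u *t u)^t*.
Proof.
move=> /unitarymxP uu.
by rewrite (adj_tens (u *t u) u) /leg12 !mxtens.tensmx_mul mulmx1 uu.
Qed.

Lemma leg23_conj u A : u \is unitarymx ->
  leg23 (local_conj u A)
  = (u *t u *t u) *m leg23 A *m (u *t u *t u)^t*.
Proof.
move=> /unitarymxP uu.
rewrite /leg23 -tensmxA adj_castmx -!castmxM (adj_tens u (u *t u)).
by rewrite !mxtens.tensmx_mul mulmx1 uu.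
Qed.

Lemma Rmatrix_conj u A :
  u \is unitarymx -> unitary_Rmatrix A -> unitary_Rmatrix (local_conj u A).
Proof.
move=> uU [AU YB]; have vU := tensmx_unitary uU; split.
  by rewrite !mul_unitarymx // trmxC_unitary.
rewrite /yang_baxter !leg12_conj // !leg23_conj //.
set w := u *t u *t u.
have wK : w^t* *m w = 1%:M.
  apply: unitarymxK; apply/unitarymxP; move/unitarymxP: (uU) => uu.
  move/unitarymxP: vU => vv.
  by rewrite /w (adj_tens (u *t u) u) mxtens.tensmx_mul vv uu tensmx11.
have wM (X Y : 'M_(d * d * d)) :
  (w *m X *m w^t*) *m (w *m Y *m w^t*) = w *m (X *m Y) *m w^t*.
  by rewrite !mulmxA -(mulmxA (w *m X)) wK mulmx1.
by rewrite !wM YB.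
Qed.

Lemma local_conjK u A : u \is unitarymx ->
  local_conj (u^t*) (local_conj u A) = A.
Proof.
move=> /tensmx_unitary/unitarymxK vK.
rewrite /local_conj -adj_tens trmxCK !mulmxA vK mul1mx.
by rewrite -mulmxA vK mulmx1.
Qed.

Lemma local_conj_comp u v A :
  local_conj u (local_conj v A) = local_conj (u *m v) A.
Proof.
by rewrite /local_conj -mxtens.tensmx_mul adjCM !mulmxA.
Qed.

Lemma Rmatrix_adj A : unitary_Rmatrix A -> unitary_Rmatrix (A^t*).
Proof.
move=> [AU YB]; split; first by rewrite trmxC_unitary.
have := congr1 (fun X : 'M_(d * d * d) => X^t*) YB.
by rewrite /yang_baxter !adjCM !adj_leg12 !adj_leg23 !mulmxA.
Qed.

(** The partial trace over the second tensor factor. *)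
Definition ptr2 A : 'M[C]_d :=
  \matrix_(i, k) \sum_j A (idx i j) (idx k j).

Lemma mxtrace_ptr2 A B : \tr (A *m (B *t 1%:M)) = \tr (ptr2 A *m B).
Proof.
rewrite /mxtrace sum_tens; apply: eq_bigr => x _.
rewrite mxE; under eq_bigr => y _ do rewrite mxE sum_tens.
rewrite exchange_big; apply: eq_bigr => z _.
rewrite mxE mulr_suml; apply: eq_bigr => y _.
rewrite (bigD1 y) //= big1 => [|t ty]; last first.
  by rewrite mxtens.tensmxE mxE (negPf ty) !mulr0.
by rewrite mxtens.tensmxE mxE eqxx addr0 mulr1.
Qed.

Lemma mxtrace_tens m n (B : 'M[C]_m) (B' : 'M[C]_n) :
  \tr (B *t B') = \tr B * \tr B'.
Proof.
rewrite /mxtrace sum_tens mulr_suml; apply: eq_bigr => x _.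
by rewrite mulr_sumr; apply: eq_bigr => y _; rewrite mxtens.tensmxE.
Qed.

Lemma ptr2_mull A B : ptr2 ((B *t 1%:M) *m A) = B *m ptr2 A.
Proof.
apply/matrixP => x z; rewrite !mxE.
under eq_bigr => y _ do rewrite mxE sum_tens.
rewrite exchange_big; apply: eq_bigr => t _.
rewrite mxE mulr_sumr; apply: eq_bigr => y _.
rewrite (bigD1 y) //= big1 => [|y' ne]; last first.
  by rewrite mxtens.tensmxE mxE eq_sym (negPf ne) mulr0 mul0r.
by rewrite mxtens.tensmxE mxE eqxx addr0 mulr1.
Qed.

Lemma ptr2_mulr A B : ptr2 (A *m (B *t 1%:M)) = ptr2 A *m B.
Proof.
apply/matrixP => x z; rewrite !mxE.
under eq_bigr => y _ do rewrite mxE sum_tens.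
rewrite exchange_big; apply: eq_bigr => t _.
rewrite mxE mulr_suml; apply: eq_bigr => y _.
rewrite (bigD1 y) //= big1 => [|y' ne]; last first.
  by rewrite mxtens.tensmxE mxE (negPf ne) !mulr0.
by rewrite mxtens.tensmxE mxE eqxx addr0 mulr1.
Qed.

Lemma ptr2C A B : ptr2 ((1%:M *t B) *m A) = ptr2 (A *m (1%:M *t B)).
Proof.
apply/matrixP => x z; rewrite !mxE.
under eq_bigr => y _ do rewrite mxE sum_tens exchange_big.
under [RHS]eq_bigr => y _ do rewrite mxE sum_tens exchange_big.
rewrite exchange_big; apply: eq_bigr => t _.
apply: eq_bigr => y _.
rewrite (bigD1 x) //= big1 => [|x' ne]; last first.
  by rewrite mxtens.tensmxE mxE eq_sym (negPf ne) !mul0r.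
rewrite [RHS](bigD1 z) //= [in RHS]big1 => [|x' ne]; last first.
  by rewrite mxtens.tensmxE mxE (negPf ne) mul0r mulr0.
by rewrite !mxtens.tensmxE !mxE !eqxx !addr0 !mul1r mulrC.
Qed.

Lemma ptr2_conj u A : u \is unitarymx ->
  ptr2 (local_conj u A) = u *m ptr2 A *m u^t*.
Proof.
move=> /unitarymxK uK; rewrite /local_conj adj_tens.
rewrite (mxtens.tensmx_decr u u) (mxtens.tensmx_decl (u^t*) (u^t*)).
rewrite !mulmxA ptr2_mulr -!mulmxA ptr2_mull ptr2C.
rewrite -!mulmxA mxtens.tensmx_mul mul1mx uK tensmx11 mulmx1.
by rewrite mulmxA.
Qed.

Lemma mxtrace_leg12_leg23 X Y :
  \tr (leg12 X *m leg23 Y) = \tr (X *m (1%:M *t ptr2 Y)).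
Proof.
rewrite /mxtrace !sum_tens; apply: eq_bigr => x _; apply: eq_bigr => y _.
under eq_bigr => z _ do rewrite mxE !sum_tens.
rewrite mxE sum_tens exchange_big; apply: eq_bigr => x' _.
rewrite exchange_big; apply: eq_bigr => y' _.
rewrite mxtens.tensmxE !mxE !mulr_sumr; apply: eq_bigr => z _.
rewrite (bigD1 z) //= big1 => [|z' ne]; last first.
  by rewrite leg12E eq_sym (negPf ne) mulr0 mul0r.
by rewrite leg12E leg23E eqxx mulr1 addr0 mulrA.
Qed.

Lemma mxtrace_leg12 X : \tr (leg12 X) = \tr X * d%:R.
Proof. by rewrite /leg12 mxtrace_tens mxtrace1. Qed.

Lemma leg1_leg23C B Y :
  leg12 (B *t 1%:M) *m leg23 Y = leg23 Y *m leg12 (B *t 1%:M).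
Proof.
rewrite /leg12 -tensmxA /leg23 -!castmxM !mxtens.tensmx_mul.
by rewrite tensmx11 !(mul1mx, mulmx1).
Qed.

Lemma sqnorm_mx_eq0 m n (W : 'M[C]_(m, n)) : \tr (W *m W^t*) = 0 -> W = 0.
Proof.
move=> trW; apply/matrixP => i j; rewrite mxE.
have sq_ge0 k : 0 <= \sum_l W k l * (W^t*) l k.
  by apply: sumr_ge0 => l _; rewrite !mxE mul_conjC_ge0.
have rowi : \sum_l W i l * (W^t*) l i = 0.
  have trW' : \sum_k \sum_l W k l * (W^t*) l k = 0.
    by rewrite -[RHS]trW; apply: eq_bigr => k _; rewrite mxE.
  exact: (psumr_eq0P (fun k _ => sq_ge0 k) trW').
have : W i j * (W^t*) j i = 0.
  apply: (psumr_eq0P _ rowi) => // l _.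
  by rewrite !mxE mul_conjC_ge0.
by rewrite !mxE => /eqP; rewrite mul_conjC_eq0 => /eqP.
Qed.

Lemma sqnorm_mx_ge0 m n (W : 'M[C]_(m, n)) : 0 <= \tr (W *m W^t*).
Proof.
apply: sumr_ge0 => i _; rewrite mxE; apply: sumr_ge0 => j _.
by rewrite !mxE mul_conjC_ge0.
Qed.

Lemma adjCB m n (X Y : 'M[C]_(m, n)) : (X - Y)^t* = X^t* - Y^t*.
Proof. by rewrite linearB map_mxB. Qed.

(** Put X = A (1 (x) T) A^* and Y = T (x) 1.  Both have squared norm
    d |T|^2, and the braid form of the Yang-Baxter equation shows that
    their inner product has this value as well; hence |X - Y|^2 = 0. *)
Lemma ptr2_swap A : unitary_Rmatrix A ->
  A *m (1%:M *t ptr2 A) = (ptr2 A *t 1%:M) *m A.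
Proof.
move=> [AU YB]; set T := ptr2 A.
have AA : A *m A^t* = 1%:M by apply/unitarymxP.
have AK : A^t* *m A = 1%:M by apply: unitarymxK.
have braid : leg12 A *m leg23 A *m leg12 (A^t*)
             = leg23 (A^t*) *m leg12 A *m leg23 A.
  transitivity
    (leg23 (A^t*) *m (leg23 A *m leg12 A *m leg23 A) *m leg12 (A^t*)).
    by rewrite !mulmxA -leg23M AK leg23_1 mul1mx.
  by rewrite -YB !mulmxA -mulmxA -leg12M AA leg12_1 mulmx1.
(* The inner product of X and Y is computed on three factors: T on the
   second factor is the trace of A23 over the third one. *)
pose c1 : 'M[C]_(d * d) := T^t* *t 1%:M.
have cross : \tr (A *m (1%:M *t T) *m A^t* *m c1) = \tr (T *m T^t*) * d%:R.
  rewrite -(mulmxA (A *m _)) mxtrace_mulC !mulmxA -mxtrace_leg12_leg23.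
  rewrite !leg12M -!mulmxA mxtrace_mulC -!mulmxA (mulmxA (leg12 A)) braid.
  rewrite !mulmxA leg1_leg23C -!mulmxA mxtrace_mulC -!mulmxA.
  rewrite -leg23M AA leg23_1 mulmx1 -leg12M mxtrace_leg12.
  by rewrite mxtrace_mulC mxtrace_ptr2.
have crossC : \tr ((T *t 1%:M) *m A *m (1%:M *t T^t*) *m A^t*)
              = \tr (T *m T^t*) * d%:R.
  have trC n (X : 'M[C]_n) : \tr (X^t*) = (\tr X)^*.
    by rewrite /mxtrace rmorph_sum; apply: eq_bigr => i _; rewrite !mxE.
  transitivity (\tr ((A *m (1%:M *t T) *m A^t* *m c1)^t*)).
    by rewrite !adjCM !adj_tens !trmxCK adjC1 !mulmxA.
  rewrite trC cross rmorphM rmorph_nat /=; congr (_ * _).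
  by rewrite -trC adjCM trmxCK.
pose W := A *m (1%:M *t T) *m A^t* - T *t 1%:M.
suff W0 : W = 0.
  move/eqP: W0; rewrite subr_eq0 => /eqP <-.
  by rewrite -!mulmxA AK mulmx1.
apply: sqnorm_mx_eq0.
rewrite adjCB !adjCM !adj_tens trmxCK adjC1 mulmxBl !mulmxBr !linearB /=.
rewrite !mulmxA crossC cross mxtens.tensmx_mul mulmx1 mxtrace_tens mxtrace1.
rewrite -(mulmxA _ (A^t*) A) AK mulmx1 -mulmxA mxtrace_mulC -!mulmxA.
rewrite (mulmxA (A^t*)) AK mul1mx mxtens.tensmx_mul mul1mx mxtrace_tens.
by rewrite mxtrace1 (mulrC d%:R) (mxtrace_mulC (T^t*)) subrr.
Qed.

End Legs.

(** * Normality of the partial traces, and the equation in coordinates *)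

Section Coordinates.
Variables (C : numClosedFieldType) (d : nat).
Implicit Types (A X Y : 'M[C]_(d * d)) (B u : 'M[C]_d).

(** The relations of ptr2_swap for A and for A^* let T^* be moved from the
    first factor to the second one, around the trace, and back to the other
    side of A: this turns T T^* into T^* T. *)
Lemma ptr2_normal A : unitary_Rmatrix A -> ptr2 A \is normalmx.
Proof.
move=> RA; have [AU _] := RA; set T := ptr2 A.
have AK : A^t* *m A = 1%:M by apply: unitarymxK.
have AA : A *m A^t* = 1%:M by apply/unitarymxP.
have ptr2_adj : ptr2 (A^t*) = T^t*.
  apply/matrixP => i k; rewrite !mxE rmorph_sum.
  by apply: eq_bigr => j _; rewrite !mxE.
have swap1 : A *m (1%:M *t T) = (T *t 1%:M) *m A := ptr2_swap RA.
have swap2 : (1%:M *t T^t*) *m A = A *m (T^t* *t 1%:M).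
  have := ptr2_swap (Rmatrix_adj RA); rewrite ptr2_adj => e.
  rewrite -[LHS]mul1mx -AA -!mulmxA (mulmxA (A^t*)) e.
  by rewrite -!mulmxA AK mulmx1.
have swap3 : A *m (1%:M *t T^t*) = (T^t* *t 1%:M) *m A.
  have := congr1 (fun X : 'M_(d * d) => A *m X^t* *m A) swap1.
  rewrite !adjCM !adj_tens !adjC1 !mulmxA -(mulmxA _ (A^t*) A) AK mulmx1 => ->.
  by rewrite AA mul1mx.
apply/normalmxP.
by rewrite -ptr2_mulr -swap2 ptr2C swap3 ptr2_mull.
Qed.

Lemma mulmx_1tensE A B x y a b :
  (A *m (1%:M *t B)) (idx x y) (idx a b)
  = \sum_t A (idx x y) (idx a t) * B t b.
Proof.
rewrite mxE sum_tens (bigD1 a) //= [X in _ + X]big1 ?addr0 => [|a' ne].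
  by apply: eq_bigr => t _; rewrite mxtens.tensmxE mxE eqxx mul1r.
by apply: big1 => t _; rewrite mxtens.tensmxE mxE (negPf ne) mul0r mulr0.
Qed.

Lemma tens1_mulmxE A B x y a b :
  ((B *t 1%:M) *m A) (idx x y) (idx a b)
  = \sum_t B x t * A (idx t y) (idx a b).
Proof.
rewrite mxE sum_tens; apply: eq_bigr => t _.
rewrite (bigD1 y) //= big1 ?addr0 => [|y' ne].
  by rewrite mxtens.tensmxE mxE eqxx mulr1.
by rewrite mxtens.tensmxE mxE eq_sym (negPf ne) mulr0 mul0r.
Qed.

Lemma leg12_mulE A (M : 'M[C]_(d * d * d)) x y z k :
  (leg12 A *m M) (idx (idx x y) z) k
  = \sum_a \sum_b A (idx x y) (idx a b) * M (idx (idx a b) z) k.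
Proof.
rewrite mxE !sum_tens; apply: eq_bigr => a _; apply: eq_bigr => b _.
rewrite (bigD1 z) //= big1 ?addr0 => [|z' ne].
  by rewrite leg12E eqxx mulr1.
by rewrite leg12E eq_sym (negPf ne) mulr0 mul0r.
Qed.

Lemma leg23_mulE A (M : 'M[C]_(d * d * d)) x y z k :
  (leg23 A *m M) (idx (idx x y) z) k
  = \sum_b \sum_c A (idx y z) (idx b c) * M (idx (idx x b) c) k.
Proof.
rewrite mxE !sum_tens (bigD1 x) //= [X in _ + X]big1 ?addr0 => [|x' ne].
  apply: eq_bigr => a _; apply: eq_bigr => b _.
  by rewrite leg23E eqxx mul1r.
apply: big1 => a _; apply: big1 => b _.
by rewrite leg23E eq_sym (negPf ne) !mul0r.
Qed.

Lemma yang_baxterP A : yang_baxter A <-> forall x y z x' y' z',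
  \sum_a \sum_b A (idx x y) (idx a b)
    * \sum_c A (idx b z) (idx c z') * A (idx a c) (idx x' y')
  = \sum_b \sum_c A (idx y z) (idx b c)
    * \sum_a A (idx x b) (idx x' a) * A (idx a c) (idx y' z').
Proof.
have lhsE x y z x' y' z' :
  (leg12 A *m leg23 A *m leg12 A) (idx (idx x y) z) (idx (idx x' y') z')
  = \sum_a \sum_b A (idx x y) (idx a b)
    * \sum_c A (idx b z) (idx c z') * A (idx a c) (idx x' y').
  rewrite -mulmxA leg12_mulE; apply: eq_bigr => a _; apply: eq_bigr => b _.
  rewrite leg23_mulE; congr (_ * _); apply: eq_bigr => c _.
  rewrite (bigD1 z') //= big1 ?addr0 => [|t ne].
    by rewrite leg12E eqxx mulr1.
  by rewrite leg12E (negPf ne) !mulr0.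
have rhsE x y z x' y' z' :
  (leg23 A *m leg12 A *m leg23 A) (idx (idx x y) z) (idx (idx x' y') z')
  = \sum_b \sum_c A (idx y z) (idx b c)
    * \sum_a A (idx x b) (idx x' a) * A (idx a c) (idx y' z').
  rewrite -mulmxA leg23_mulE; apply: eq_bigr => a _; apply: eq_bigr => b _.
  rewrite leg12_mulE; congr (_ * _).
  rewrite (bigD1 x') //= [X in _ + X]big1 ?addr0 => [|t ne].
    by apply: eq_bigr => c _; rewrite leg23E eqxx mul1r.
  by apply: big1 => c _; rewrite leg23E (negPf ne) mul0r mulr0.
split=> [YB x y z x' y' z'|YB]; first by rewrite -lhsE -rhsE YB.
apply: eq_tensmx => i z k z'.
case: (mxtens.mxtens_indexP i) => x y; case: (mxtens.mxtens_indexP k) => x' y'.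
by rewrite lhsE rhsE.
Qed.

Definition swap_idx (k : 'I_(d * d)) : 'I_(d * d) :=
  idx (mxtens.mxtens_unindex k).2 (mxtens.mxtens_unindex k).1.

(** Conjugation by the exchange of the two tensor factors. *)
Definition flip A : 'M[C]_(d * d) :=
  \matrix_(i, j) A (swap_idx i) (swap_idx j).

Lemma flipE A x y a b : flip A (idx x y) (idx a b) = A (idx y x) (idx b a).
Proof. by rewrite mxE /swap_idx !mxtens.mxtens_indexK. Qed.

Lemma flipK A : flip (flip A) = A.
Proof. by apply: eq_tensmx => x y a b; rewrite !flipE. Qed.

Lemma flipM X Y : flip (X *m Y) = flip X *m flip Y.
Proof.
apply: eq_tensmx => x y a b; rewrite flipE !mxE !sum_tens exchange_big.
by apply: eq_bigr => i _; apply: eq_bigr => j _; rewrite !flipE.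
Qed.

Lemma flip_adj A : (flip A)^t* = flip (A^t*).
Proof. by apply/matrixP => i j; rewrite !mxE. Qed.

Lemma flip_tens B B' : flip (B *t B') = B' *t B.
Proof. by apply: eq_tensmx => x y a b; rewrite flipE !mxtens.tensmxE mulrC. Qed.

Lemma flip_conj u A : flip (local_conj u A) = local_conj u (flip A).
Proof. by rewrite /local_conj !flipM -flip_adj flip_tens. Qed.

Lemma Rmatrix_flip A : unitary_Rmatrix A -> unitary_Rmatrix (flip A).
Proof.
move=> [/unitarymxP AU /yang_baxterP YB]; split.
  by apply/unitarymxP; rewrite flip_adj -flipM AU -tensmx11 flip_tens.
apply/yang_baxterP => x y z x' y' z'.
have := YB z y x z' y' x'; under eq_bigr do under eq_bigr do rewrite mulr_sumr.
move=> e; symmetry.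
transitivity (\sum_a \sum_b A (idx z y) (idx a b)
    * \sum_c A (idx b x) (idx c x') * A (idx a c) (idx z' y')).
  rewrite exchange_big; apply: eq_bigr => a _; apply: eq_bigr => b _.
  by rewrite flipE; congr (_ * _); apply: eq_bigr => c _; rewrite !flipE.
rewrite YB exchange_big; apply: eq_bigr => a _; apply: eq_bigr => b _.
by rewrite flipE; congr (_ * _); apply: eq_bigr => c _; rewrite !flipE.
Qed.

End Coordinates.

(** * A partial trace that is not scalar *)

Section Unitary.
Variables (C : numClosedFieldType) (n : nat).
Implicit Types (A : 'M[C]_n).

Lemma unitary_sqnorm_row A i : A \is unitarymx -> \sum_k `|A i k| ^+ 2 = 1.
Proof.
move=> /unitarymxP/matrixP/(_ i i); rewrite !mxE eqxx mulr1n => <-.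
by apply: eq_bigr => k _; rewrite !mxE normCK.
Qed.

Lemma unitary_monomial_row A i j : A \is unitarymx ->
  (forall k, k != j -> A i k = 0) -> `|A i j| = 1.
Proof.
move=> /(unitary_sqnorm_row i) sumA A0; apply/eqP.
rewrite -(@pexpr_eq1 _ _ 2) //; apply/eqP; rewrite -[RHS]sumA (bigD1 j) //=.
by rewrite big1 ?addr0 // => k /A0->; rewrite normr0 expr0n.
Qed.

Lemma unitary_monomial_col A i j : A \is unitarymx ->
  `|A i j| = 1 -> forall k, k != i -> A k j = 0.
Proof.
rewrite -trmxC_unitary => /(unitary_sqnorm_row j) sumA A1 k ki.
move: sumA; rewrite (bigD1 i) //= !mxE norm_conjC A1 expr1n.
move/(canRL (addKr 1)); rewrite addNr => sum0.
have : `|(A^t*) j k| ^+ 2 = 0.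
  by apply: (psumr_eq0P _ sum0) => // l _; rewrite exprn_ge0.
by rewrite !mxE norm_conjC => /eqP; rewrite expf_eq0 normr_eq0 => /eqP.
Qed.

End Unitary.

Section Two.
Variable C : numClosedFieldType.
Implicit Types (A B : 'M[C]_(2 * 2)) (u : 'M[C]_2).

Lemma ord2P (x : 'I_2) : x = 0 \/ x = 1.
Proof. by case: x => -[|[|//]] ?; [left | right]; apply: val_inj. Qed.

Lemma sum2 (F : 'I_2 -> C) : \sum_i F i = F 0 + F 1.
Proof.
by rewrite !big_ord_recl big_ord0 addr0; congr (_ + F _); apply: val_inj.
Qed.

Definition classified A := exists u B,
  [/\ u \is unitarymx, representative B & A = local_conj u B].

Lemma classified_conj u A :
  u \is unitarymx -> classified (local_conj u A) -> classified A.
Proof.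
move=> uU [v [B [vU RB AE]]]; exists (u^t* *m v), B; split=> //.
  by rewrite mul_unitarymx // trmxC_unitary.
by rewrite -local_conj_comp -AE local_conjK.
Qed.

Lemma local_conj1 A : local_conj 1%:M A = A.
Proof. by rewrite /local_conj tensmx11 adjC1 mul1mx mulmx1. Qed.

Lemma classified_representative A : representative A -> classified A.
Proof.
move=> RA; exists 1%:M, A; split=> //; last by rewrite local_conj1.
by apply/unitarymxP; rewrite adjC1 mulmx1.
Qed.

(** The zero pattern of the family R2: e_x (x) e_y is sent to a multiple of
    e_y (x) e_x. *)
Definition swap_pattern A :=
  forall x y a b, (a, b) != (y, x) -> A (idx x y) (idx a b) = 0.

Lemma representative_R2 A :
  A \is unitarymx -> swap_pattern A -> representative A.
Proof.
move=> AU A0.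
have AE : A = R2 (A (idx 0 0) (idx 0 0)) (A (idx 0 1) (idx 1 0))
                 (A (idx 1 0) (idx 0 1)) (A (idx 1 1) (idx 1 1)).
  apply: eq_tensmx => x y a b; rewrite [RHS]mxE.
  by case: (ord2P x) => ->; case: (ord2P y) => ->;
    case: (ord2P a) => ->; case: (ord2P b) => -> //=; apply: A0.
have A1 x y : `|A (idx x y) (idx y x)| = 1.
  apply: unitary_monomial_row => // k.
  case: (mxtens.mxtens_indexP k) => a b ne; apply: A0.
  by apply: contraNneq ne => -[-> ->].
by rewrite AE; constructor; apply: A1.
Qed.

Lemma representative_R3 A : A \is unitarymx ->
  (forall x y a b, (a, b) != (1 - y, 1 - x) -> A (idx x y) (idx a b) = 0) ->
  A (idx 0 1) (idx 0 1) = A (idx 1 0) (idx 1 0) ->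
  representative A.
Proof.
move=> AU A0 Aq.
have AE : A = R3 (A (idx 0 0) (idx 1 1)) (A (idx 0 1) (idx 0 1))
                 (A (idx 1 1) (idx 0 0)).
  apply: eq_tensmx => x y a b; rewrite [RHS]mxE.
  by case: (ord2P x) => ->; case: (ord2P y) => ->;
    case: (ord2P a) => ->; case: (ord2P b) => -> //=; apply: A0.
have A1 x y : `|A (idx x y) (idx (1 - y) (1 - x))| = 1.
  apply: unitary_monomial_row => // k.
  case: (mxtens.mxtens_indexP k) => a b ne; apply: A0.
  by apply: contraNneq ne => -[-> ->].
rewrite AE; constructor; [have := A1 0 0 | have := A1 0 1 | have := A1 1 1].
all: by rewrite ?subrr ?subr0.
Qed.

(** In an eigenbasis of T the relation of ptr2_swap says that
    A (xy; ab) T_b = T_x A (xy; ab), so A (xy; ab) = 0 unless b = x.  Then T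
    is diagonal only if A (xx; ax) = 0 for a <> x, and unitarity clears the
    columns of the entries A (xx; xx). *)
Lemma ptr2_diag_swap_pattern A : unitary_Rmatrix A -> is_diag_mx (ptr2 A) ->
  ptr2 A 0 0 != ptr2 A 1 1 -> swap_pattern A.
Proof.
move=> RA /is_diag_mxP dT ne; have [AU _] := RA.
have A0 x y a b : b != x -> A (idx x y) (idx a b) = 0.
  move=> bx; have T0 : ptr2 A b b != ptr2 A x x.
    by case: (ord2P x) bx => ->; case: (ord2P b) => -> // _;
      rewrite 1?eq_sym // eq_sym.
  have /matrixP/(_ (idx x y) (idx a b)) := ptr2_swap RA.
  rewrite mulmx_1tensE tens1_mulmxE (bigD1 b) //= big1; last first.
    by move=> t tb; rewrite dT ?mulr0.
  rewrite (bigD1 x) //= [in RHS]big1 => [|t tx]; last first.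
    by rewrite dT ?mul0r // eq_sym.
  move/eqP; rewrite !addr0 mulrC -subr_eq0 -mulrBl mulf_eq0 subr_eq0.
  by rewrite (negPf T0) => /eqP.
have diag0 x a : a != x -> A (idx x x) (idx a x) = 0.
  move=> ax; have := dT x a; rewrite val_eqE eq_sym => /(_ ax).
  rewrite mxE (bigD1 x) //= big1 ?addr0 // => y yx; exact: A0.
have diag1 x : `|A (idx x x) (idx x x)| = 1.
  apply: unitary_monomial_row => // k.
  case: (mxtens.mxtens_indexP k) => a b.
  have [->|bx _] := eqVneq b x; last exact: A0.
  by have [->|ax _] := eqVneq a x; rewrite ?eqxx // diag0.
move=> x y a b; rewrite xpair_eqE; have [->|bx _] := eqVneq b x; last exact: A0.
rewrite andbT => ay; have [xy|xy] := eqVneq y x; first by rewrite xy diag0 -?xy.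
have -> : a = x by case: (ord2P x) (ord2P y) (ord2P a) xy ay => -> [] -> [] ->.
apply: (unitary_monomial_col AU (diag1 x)).
by rewrite (can_eq (@mxtens.mxtens_indexK 2 2)) xpair_eqE (negPf xy) andbF.
Qed.

Lemma ptr2_nonscalar A : unitary_Rmatrix A -> ~~ is_scalar_mx (ptr2 A) ->
  exists2 u, u \is unitarymx & swap_pattern (local_conj u A).
Proof.
move=> RA nsT; have /orthomx_spectralP TE := ptr2_normal RA.
set P := spectralmx _ in TE; set D := spectral_diag _ in TE.
have PU : P \is unitarymx by apply: spectral_unitarymx.
have TD : ptr2 (local_conj P A) = diag_mx D.
  rewrite ptr2_conj // TE invmx_unitary // !mulmxA; move/unitarymxP: PU => PP.
  by rewrite PP mul1mx -mulmxA PP mulmx1.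
exists P => //; apply: ptr2_diag_swap_pattern; first exact: Rmatrix_conj.
  by rewrite TD diag_mx_is_diag.
rewrite TD !mxE !eqxx !mulr1n; apply: contraNneq nsT => D01.
apply/is_scalar_mxP; exists (D 0 0).
have -> : ptr2 A = invmx P *m (D 0 0)%:M *m P.
  rewrite TE; congr (_ *m _ *m _); apply/matrixP => i j.
  by rewrite !mxE; case: (ord2P i) => ->; rewrite ?D01.
by rewrite mul_mx_scalar -scalemxAl mulVmx ?unitarymx_unit // scalemx1.
Qed.

Lemma ptr_nonscalar_classified A : unitary_Rmatrix A ->
  ~~ (is_scalar_mx (ptr2 A) && is_scalar_mx (ptr2 (flip A))) -> classified A.
Proof.
move=> RA; have [AU _] := RA.
have main u : u \is unitarymx -> swap_pattern (local_conj u A) -> classified A.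
  move=> uU pat; apply: (classified_conj uU); apply: classified_representative.
  by apply: representative_R2 => //; have [] := Rmatrix_conj uU RA.
rewrite negb_and => /orP[] ns; first by case: (ptr2_nonscalar RA ns) => u /main.
case: (ptr2_nonscalar (Rmatrix_flip RA) ns) => u uU pat.
apply: (main u) => // x y a b ne.
rewrite -[A]flipK -flip_conj flipE pat //.
by move: ne; rewrite !xpair_eqE andbC.
Qed.

End Two.

(** * The Pauli form *)

Lemma ord3P (i : 'I_3) : [\/ i = 0, i = 1 | i = 2%:R].
Proof.
by case: i => -[|[|[|//]]] ?; [constructor 1 | constructor 2 | constructor 3];
  apply: val_inj.
Qed.

Lemma sum3 (R : nmodType) (F : 'I_3 -> R) :
  \sum_i F i = F 0 + F 1 + F 2%:R.
Proof.
rewrite !big_ord_recl big_ord0 addr0 addrA.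
by congr (_ + F _ + F _); apply: val_inj.
Qed.

Section Pauli.
Variable C : numClosedFieldType.
Implicit Types (A B : 'M[C]_(2 * 2)) (u : 'M[C]_2) (c : 'M[C]_3) (t : C).

Definition sigma (i : 'I_3) : 'M[C]_2 :=
  \matrix_(x, y) nth 0 (nth [::] (nth [::]
    [:: [:: [:: 0; 1]; [:: 1; 0]];
        [:: [:: 0; - 'i]; [:: 'i; 0]];
        [:: [:: 1; 0]; [:: 0; -1]]] i) x) y.

Definition pauli t c : 'M[C]_(2 * 2) :=
  t%:M + \sum_i \sum_j c i j *: (sigma i *t sigma j).

Lemma pauli_coefE t c x y a b :
  pauli t c (idx x y) (idx a b) = t * (x == a)%:R * (y == b)%:R
    + \sum_i \sum_j c i j * sigma i x a * sigma j y b.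
Proof.
rewrite mxE -scalemx1 -tensmx11 mxE mxtens.tensmxE !mxE mulrA; congr (_ + _).
rewrite summxE; apply: eq_bigr => i _; rewrite summxE; apply: eq_bigr => j _.
by rewrite mxE mxtens.tensmxE mulrA.
Qed.

(** The polarisation of the cofactor matrix: crossmx c c = 2 cofmx c.  It is
    the sigma (x) sigma part of a product of two Pauli forms, up to sign.  The
    indices are shifted cyclically, so that no signs are needed. *)
Definition crossmx c c' : 'M[C]_3 := \matrix_(i, j)
  (c (i + 1) (j + 1) * c' (i + 2%:R) (j + 2%:R)
   + c (i + 2%:R) (j + 2%:R) * c' (i + 1) (j + 1)
   - c (i + 1) (j + 2%:R) * c' (i + 2%:R) (j + 1)
   - c (i + 2%:R) (j + 1) * c' (i + 1) (j + 2%:R)).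

Definition cofmx c : 'M[C]_3 := \matrix_(i, j)
  (c (i + 1) (j + 1) * c (i + 2%:R) (j + 2%:R)
   - c (i + 1) (j + 2%:R) * c (i + 2%:R) (j + 1)).

Lemma ord3_addE : ((0 + 1 = 1 :> 'I_3)%R * (1 + 1 = 2%:R :> 'I_3)%R
  * (2%:R + 1 = 0 :> 'I_3)%R * (0 + 2%:R = 2%:R :> 'I_3)%R
  * (1 + 2%:R = 0 :> 'I_3)%R * (2%:R + 2%:R = 1 :> 'I_3)%R)%type.
Proof. by do ![split]; apply: val_inj. Qed.

(** The sixteen entries written out, so that they can be computed by case
    analysis on the indices. *)
Definition pauli_entry t c (x y a b : 'I_2) : C :=
  match val x, val y, val a, val b with
  | 0%N, 0%N, 0%N, 0%N => t + c 2%:R 2%:R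
  | 0%N, 0%N, 0%N, _ => c 2%:R 0 - 'i * c 2%:R 1
  | 0%N, 0%N, _, 0%N => c 0 2%:R - 'i * c 1 2%:R
  | 0%N, 0%N, _, _ => c 0 0 - c 1 1 - 'i * (c 0 1 + c 1 0)
  | 0%N, _, 0%N, 0%N => c 2%:R 0 + 'i * c 2%:R 1
  | 0%N, _, 0%N, _ => t - c 2%:R 2%:R
  | 0%N, _, _, 0%N => c 0 0 + c 1 1 + 'i * (c 0 1 - c 1 0)
  | 0%N, _, _, _ => - c 0 2%:R + 'i * c 1 2%:R
  | _, 0%N, 0%N, 0%N => c 0 2%:R + 'i * c 1 2%:R
  | _, 0%N, 0%N, _ => c 0 0 + c 1 1 - 'i * (c 0 1 - c 1 0)
  | _, 0%N, _, 0%N => t - c 2%:R 2%:R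
  | _, 0%N, _, _ => - c 2%:R 0 + 'i * c 2%:R 1
  | _, _, 0%N, 0%N => c 0 0 - c 1 1 + 'i * (c 0 1 + c 1 0)
  | _, _, 0%N, _ => - c 0 2%:R - 'i * c 1 2%:R
  | _, _, _, 0%N => - c 2%:R 0 - 'i * c 2%:R 1
  | _, _, _, _ => t + c 2%:R 2%:R
  end.

Lemma pauliE t c x y a b :
  pauli t c (idx x y) (idx a b) = pauli_entry t c x y a b.
Proof.
rewrite pauli_coefE !sum3 !mxE.
by case: (ord2P x) => ->; case: (ord2P y) => ->; case: (ord2P a) => ->;
  case: (ord2P b) => -> /=; rewrite /pauli_entry /=; ring: (sqrCi C).
Qed.

Section YangBaxterCoefficients.
Variables (t : C) (c : 'M[C]_3).
Hypothesis YB : yang_baxter (pauli t c).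

(** One entry of the difference of the two sides of the Yang-Baxter
    equation. *)
Definition yb_defect x y z x' y' z' : C :=
  let A := pauli_entry t c in
    A x y 0 0 * (A 0 z 0 z' * A 0 0 x' y' + A 0 z 1 z' * A 0 1 x' y')
  + A x y 0 1 * (A 1 z 0 z' * A 0 0 x' y' + A 1 z 1 z' * A 0 1 x' y')
  + A x y 1 0 * (A 0 z 0 z' * A 1 0 x' y' + A 0 z 1 z' * A 1 1 x' y')
  + A x y 1 1 * (A 1 z 0 z' * A 1 0 x' y' + A 1 z 1 z' * A 1 1 x' y')
  - (A y z 0 0 * (A x 0 x' 0 * A 0 0 y' z' + A x 0 x' 1 * A 1 0 y' z')
  + A y z 0 1 * (A x 0 x' 0 * A 0 1 y' z' + A x 0 x' 1 * A 1 1 y' z')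
  + A y z 1 0 * (A x 1 x' 0 * A 0 0 y' z' + A x 1 x' 1 * A 1 0 y' z')
  + A y z 1 1 * (A x 1 x' 0 * A 0 1 y' z' + A x 1 x' 1 * A 1 1 y' z')).

Lemma yb_defect0 x y z x' y' z' : yb_defect x y z x' y' z' = 0.
Proof.
rewrite /yb_defect; set A := pauli_entry t c.
have := proj1 (yang_baxterP _) YB x y z x' y' z'.
by rewrite !sum2 !pauliE -/A !addrA => ->; rewrite subrr.
Qed.

(** Each row x of a Pauli matrix has a single nonzero entry, in column
    sigma_col i x.  The value sigma_phase i x is the entry at the transposed
    position, so that summing a matrix M against it computes the trace of
    sigma_i M. *)
Definition sigma_col (i : 'I_3) (x : 'I_2) : 'I_2 :=
  if val i == 2%N then x else if val x == 0%N then 1 else 0.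

Definition sigma_phase (i : 'I_3) (x : 'I_2) : C :=
  if val i == 0%N then 1 else
  if val i == 1%N then if val x == 0%N then 'i else - 'i
  else if val x == 0%N then 1 else -1.

(** The coefficient of 1 (x) sigma_b (x) sigma_q is extracted by a trace over
    C^8, which explains the factor 8; in yb_trace_leg2 the identity is on the
    second factor and the coefficient itself is even. *)
Lemma yb_trace_leg1 (b q : 'I_3) (X : C) :
  8%:R * X = \sum_x \sum_y \sum_z sigma_phase b y * sigma_phase q z
    * yb_defect x y z x (sigma_col b y) (sigma_col q z) -> X = 0.
Proof.
move=> e; apply/eqP; rewrite -(mulrI_eq0 X (_ : GRing.lreg (8%:R : C))).
  rewrite e; apply/eqP.
  do 3![apply: big1 => ? _]; by rewrite yb_defect0 mulr0.
by apply: mulfI; rewrite pnatr_eq0.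
Qed.

Lemma yb_trace_leg2 (b q : 'I_3) (X : C) :
  16%:R * X = \sum_x \sum_y \sum_z sigma_phase b x * sigma_phase q z
    * yb_defect x y z (sigma_col b x) y (sigma_col q z) -> X = 0.
Proof.
move=> e; apply/eqP; rewrite -(mulrI_eq0 X (_ : GRing.lreg (16%:R : C))).
  rewrite e; apply/eqP.
  do 3![apply: big1 => ? _]; by rewrite yb_defect0 mulr0.
by apply: mulfI; rewrite pnatr_eq0.
Qed.

(** The coefficients of 1 (x) sigma_i (x) sigma_j. *)
Lemma pauli_yb_cubic :
  2%:R *: (c^T *m c *m c) - \tr (c^T *m c) *: c
  = t ^+ 2 *: c - (2%:R * t) *: cofmx c.
Proof.
apply/subr0_eq/matrixP => i j; rewrite [RHS]mxE.
apply: (yb_trace_leg1 (b := i) (q := j)).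
rewrite !(sum3, sum2) /mxtrace !(sum3, mxE).
case: (ord3P i) => ->; case: (ord3P j) => ->;
  rewrite !ord3_addE /yb_defect /sigma_phase /sigma_col /= /pauli_entry /=;
  ring: (sqrCi C).
Qed.

(** The coefficients of sigma_i (x) 1 (x) sigma_j. *)
Lemma pauli_yb_cofmx : cofmx c *m c = c *m cofmx c.
Proof.
apply/subr0_eq/matrixP => i j; rewrite [RHS]mxE.
apply: (yb_trace_leg2 (b := i) (q := j)); rewrite !(sum3, sum2) !(sum3, mxE).
case: (ord3P i) => ->; case: (ord3P j) => ->;
  rewrite !ord3_addE /yb_defect /sigma_phase /sigma_col /= /pauli_entry /=;
  ring: (sqrCi C).
Qed.

End YangBaxterCoefficients.
End Pauli.

Notation conj_mx c := (map_mx Num.conj c).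

Section PauliUnitary.
Variable C : numClosedFieldType.
Implicit Types (A B : 'M[C]_(2 * 2)) (u : 'M[C]_2) (c : 'M[C]_3) (t s : C).

Lemma sigma_hermitian i : (sigma C i)^t* = sigma C i.
Proof.
apply/matrixP => x y; rewrite !mxE.
by case: (ord3P i) => ->; case: (ord2P x) => ->; case: (ord2P y) => -> /=;
  rewrite ?(rmorph0, rmorph1, rmorphN) //= ?conjCi ?opprK.
Qed.

Lemma sigma_conj i x y : (sigma C i x y)^* = sigma C i y x.
Proof. by rewrite -{2}sigma_hermitian [in RHS]mxE [in RHS]mxE. Qed.

Lemma pauli_adj t c : (pauli t c)^t* = pauli t^* (conj_mx c).
Proof.
apply: eq_tensmx => x y a b; rewrite 2!mxE !pauli_coefE rmorphD !rmorphM.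
rewrite !rmorph_nat !(eq_sym _ x) !(eq_sym _ y) /=; congr (_ + _).
rewrite rmorph_sum; apply: eq_bigr => i _.
rewrite rmorph_sum; apply: eq_bigr => j _; rewrite !rmorphM.
by rewrite /= !sigma_conj [in RHS]mxE.
Qed.

(** Coefficients of the equation pauli t c *m pauli s c' = 1; unitarity is the
    case where s and c' are the conjugates of t and c. *)
Section PauliInverse.
Variables (t s : C) (c c' : 'M[C]_3).
Hypothesis inv : pauli t c *m pauli s c' = 1%:M.

Definition inv_defect x y x' y' : C :=
  let A := pauli_entry t c in let A' := pauli_entry s c' in
  A x y 0 0 * A' 0 0 x' y' + A x y 0 1 * A' 0 1 x' y'
  + (A x y 1 0 * A' 1 0 x' y' + A x y 1 1 * A' 1 1 x' y')
  - (x == x')%:R * (y == y')%:R.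

Lemma inv_defect0 x y x' y' : inv_defect x y x' y' = 0.
Proof.
have /matrixP/(_ (idx x y) (idx x' y')) := inv.
rewrite mxE sum_tens !sum2 !pauliE -tensmx11 mxtens.tensmxE /inv_defect => ->.
by rewrite !mxE subrr.
Qed.

Lemma inv_defect_trace (f g : 'I_2 -> 'I_2) (w : 'I_2 -> 'I_2 -> C) (X : C) :
  4%:R * X = \sum_x \sum_y w x y * inv_defect x y (f x) (g y) -> X = 0.
Proof.
move=> e; apply/eqP; rewrite -(mulrI_eq0 X (_ : GRing.lreg (4%:R : C))).
  rewrite e; apply/eqP.
  by do 2![apply: big1 => ? _]; rewrite inv_defect0 mulr0.
by apply: mulfI; rewrite pnatr_eq0.
Qed.

Lemma pauli_inv_cross : t *: c' + s *: c = crossmx c c'.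
Proof.
apply/subr0_eq/matrixP => i j; rewrite [RHS]mxE.
apply: (inv_defect_trace (f := sigma_col i) (g := sigma_col j)
  (w := fun x y => sigma_phase C i x * sigma_phase C j y)).
rewrite !sum2 !mxE.
by case: (ord3P i) => ->; case: (ord3P j) => ->;
  rewrite !ord3_addE /inv_defect /sigma_phase /sigma_col /pauli_entry /=;
  ring: (sqrCi C).
Qed.

Lemma pauli_inv_norm : t * s + \tr (c *m c'^T) = 1.
Proof.
apply/subr0_eq.
apply: (inv_defect_trace (f := id) (g := id) (w := fun x y => 1)).
rewrite !sum2 /mxtrace !(sum3, mxE).
rewrite /inv_defect /pauli_entry /=.
by ring: (sqrCi C).
Qed.

(** The sigma (x) 1 part of the product is the antisymmetric part of c c'^T,
    and its 1 (x) sigma part is that of c^T c'. *)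
Lemma pauli_inv_syml : (c *m c'^T)^T = c *m c'^T.
Proof.
suff e i : (c *m c'^T) (i + 1) (i + 2%:R) = (c *m c'^T) (i + 2%:R) (i + 1).
  apply/matrixP => i j; rewrite mxE; have := (e 0, e 1, e 2%:R).
  rewrite !ord3_addE => -[[e12 e20] e01].
  by case: (ord3P i) => ->; case: (ord3P j) => ->.
apply/subr0_eq; apply: (mulfI (neq0Ci C)); rewrite mulr0.
apply: (inv_defect_trace (f := sigma_col i) (g := id)
  (w := fun x y => sigma_phase C i x)).
rewrite !sum2 !(sum3, mxE).
by case: (ord3P i) => ->;
  rewrite !ord3_addE /inv_defect /sigma_phase /sigma_col /pauli_entry /=;
  ring: (sqrCi C).
Qed.

Lemma pauli_inv_symr : (c^T *m c')^T = c^T *m c'.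
Proof.
suff e i : (c^T *m c') (i + 1) (i + 2%:R) = (c^T *m c') (i + 2%:R) (i + 1).
  apply/matrixP => i j; rewrite mxE; have := (e 0, e 1, e 2%:R).
  rewrite !ord3_addE => -[[e12 e20] e01].
  by case: (ord3P i) => ->; case: (ord3P j) => ->.
apply/subr0_eq; apply: (mulfI (neq0Ci C)); rewrite mulr0.
apply: (inv_defect_trace (f := id) (g := sigma_col i)
  (w := fun x y => sigma_phase C i y)).
rewrite !sum2 !(sum3, mxE).
by case: (ord3P i) => ->;
  rewrite !ord3_addE /inv_defect /sigma_phase /sigma_col /pauli_entry /=;
  ring: (sqrCi C).
Qed.

End PauliInverse.

(** Scalar partial traces are exactly the vanishing of the components of A on
    sigma_i (x) 1 and 1 (x) sigma_i. *)
Lemma scalar_ptr_pauli A :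
  is_scalar_mx (ptr2 A) -> is_scalar_mx (ptr2 (flip A)) ->
  exists t c, A = pauli t c.
Proof.
move=> /is_scalar_mxP[s /matrixP T] /is_scalar_mxP[s' /matrixP S].
pose e x y z w := A (idx x y) (idx z w).
pose c := \matrix_(i, j) nth 0 (nth [::]
   [:: [:: (e 0 0 1 1 + e 1 1 0 0 + e 0 1 1 0 + e 1 0 0 1) / 4%:R;
           'i * (e 0 0 1 1 - e 1 1 0 0 - e 0 1 1 0 + e 1 0 0 1) / 4%:R;
           (e 0 0 1 0 + e 1 0 0 0) / 2%:R];
       [:: 'i * (e 0 0 1 1 - e 1 1 0 0 + e 0 1 1 0 - e 1 0 0 1) / 4%:R;
           (e 0 1 1 0 + e 1 0 0 1 - e 0 0 1 1 - e 1 1 0 0) / 4%:R;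
           'i * (e 0 0 1 0 - e 1 0 0 0) / 2%:R];
       [:: (e 0 0 0 1 + e 0 1 0 0) / 2%:R;
           'i * (e 0 0 0 1 - e 0 1 0 0) / 2%:R;
           (e 0 0 0 0 - e 0 1 0 1) / 2%:R]] (i : 'I_3)) (j : 'I_3).
exists ((e 0 0 0 0 + e 0 1 0 1) / 2%:R), c.
have eT i k : e i 0 k 0 + e i 1 k 1 = s * (i == k)%:R.
  by rewrite mulr_natr; have := T i k; rewrite !mxE sum2.
have eS i k : e 0 i 0 k + e 1 i 1 k = s' * (i == k)%:R.
  by rewrite mulr_natr; have := S i k; rewrite !mxE sum2 !flipE.
apply: eq_tensmx => x y a b; rewrite pauliE -/(e x y a b).
have [eT01 eT10 eS01 eS10] : [/\ e 0 1 1 1 = - e 0 0 1 0,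
  e 1 1 0 1 = - e 1 0 0 0, e 1 0 1 1 = - e 0 0 0 1 &
  e 1 1 1 0 = - e 0 1 0 0].
  by split; apply/eqP; rewrite -addr_eq0 addrC ?(eT, eS) mulr0.
have [e1010 e1111] : e 1 0 1 0 = e 0 1 0 1 /\ e 1 1 1 1 = e 0 0 0 0.
  have [T0 T1] := (eT 0 0, eT 1 1); have [S0 S1] := (eS 0 0, eS 1 1).
  have two : 2%:R != 0 :> C by rewrite pnatr_eq0.
  split; apply/subr0_eq/(mulfI two); rewrite mulr0.
    transitivity ((e 1 0 1 0 + e 1 1 1 1) - (e 0 0 0 0 + e 0 1 0 1)
      + (e 0 0 0 0 + e 1 0 1 0) - (e 0 1 0 1 + e 1 1 1 1)); first by ring.
    by rewrite T0 T1 S0 S1; ring.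
  transitivity ((e 1 0 1 0 + e 1 1 1 1) - (e 0 0 0 0 + e 0 1 0 1)
    - (e 0 0 0 0 + e 1 0 1 0) + (e 0 1 0 1 + e 1 1 1 1)); first by ring.
  by rewrite T0 T1 S0 S1; ring.
rewrite /pauli_entry !mxE /=; clearbody e.
by case: (ord2P x) => ->; case: (ord2P y) => ->; case: (ord2P a) => ->;
  case: (ord2P b) => -> /=; rewrite ?(eT01, eT10, eS01, eS10, e1010, e1111);
  field: (sqrCi C).
Qed.

End PauliUnitary.

(** * The rotation induced by a unitary matrix *)

Section Rotation.
Variable C : numClosedFieldType.
Implicit Types (A B : 'M[C]_(2 * 2)) (u H : 'M[C]_2) (c O : 'M[C]_3).
Implicit Types (t s : C) (n m : 'cV[C]_3).

Definition sigma_vec n : 'M[C]_2 := \sum_i n i 0 *: sigma C i.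

Lemma sigma_vecE n x y : sigma_vec n x y = \sum_i n i 0 * sigma C i x y.
Proof. by rewrite summxE; apply: eq_bigr => i _; rewrite mxE. Qed.

Lemma mxtrace_sigma_vec n : \tr (sigma_vec n) = 0.
Proof. by rewrite /mxtrace sum2 !sigma_vecE !sum3 !mxE /=; ring: (sqrCi C). Qed.

Lemma mxtrace_sigma_vecM n m :
  \tr (sigma_vec n *m sigma_vec m) = 2%:R * (n^T *m m) 0 0.
Proof.
rewrite /mxtrace sum2 !mxE !sum2 !sigma_vecE !sum3 !mxE /=.
ring: (sqrCi C).
Qed.

Definition sigma_coord H : 'cV[C]_3 := \col_i (\tr (sigma C i *m H) / 2%:R).

Lemma sigma_vecK n : sigma_coord (sigma_vec n) = n.
Proof.
apply/matrixP => i j; rewrite ord1 mxE /mxtrace sum2 !mxE !sum2.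
rewrite !sigma_vecE !sum3 !mxE.
by case: (ord3P i) => -> /=; field: (sqrCi C).
Qed.

Lemma sigma_coordK H : \tr H = 0 -> sigma_vec (sigma_coord H) = H.
Proof.
rewrite /mxtrace sum2 => /eqP; rewrite addr_eq0 => /eqP tr0.
apply/matrixP => x y; rewrite sigma_vecE sum3 !mxE /mxtrace !sum2 !mxE.
rewrite !sum2 !mxE /=.
by case: (ord2P x) => ->; case: (ord2P y) => -> /=;
  rewrite ?tr0; field: (sqrCi C).
Qed.

(** The adjoint action of u on traceless matrices, in the Pauli basis. *)
Definition so3 u : 'M[C]_3 :=
  \matrix_(i, j) sigma_coord (u *m sigma C j *m u^t*) i 0.

Lemma mxtrace_conj u H : u \is unitarymx -> \tr (u *m H *m u^t*) = \tr H.
Proof. by move/unitarymxK => uK; rewrite mxtrace_mulC mulmxA uK mul1mx. Qed.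

Lemma so3_sigma_vec u n : u \is unitarymx ->
  u *m sigma_vec n *m u^t* = sigma_vec (so3 u *m n).
Proof.
move=> uU; have -> : u *m sigma_vec n *m u^t*
    = \sum_j n j 0 *: (u *m sigma C j *m u^t*).
  rewrite mulmx_sumr mulmx_suml; apply: eq_bigr => j _.
  by rewrite -scalemxAr -scalemxAl.
have sigE j :
    u *m sigma C j *m u^t* = sigma_vec (sigma_coord (u *m sigma C j *m u^t*)).
  rewrite sigma_coordK // mxtrace_conj //.
  by case: (ord3P j) => ->; rewrite /mxtrace sum2 !mxE /=; ring.
under eq_bigr => j _ do rewrite sigE.
apply/matrixP => x y; rewrite summxE sigma_vecE.
under eq_bigr => j _ do rewrite mxE sigma_vecE mulr_sumr.
rewrite exchange_big; apply: eq_bigr => i _.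
rewrite [(so3 u *m n) i 0]mxE mulr_suml; apply: eq_bigr => j _.
by rewrite [so3 u i j]mxE; ring.
Qed.

(** The bilinear form n^T m is half the trace of a product of two traceless
    matrices, which conjugation preserves. *)
Lemma so3_orthogonal u : u \is unitarymx -> (so3 u)^T *m so3 u = 1%:M.
Proof.
move=> uU.
have e n m : ((so3 u *m n)^T *m (so3 u *m m)) 0 0 = (n^T *m m) 0 0.
  apply: (mulfI (_ : 2%:R != 0 :> C)); first by rewrite pnatr_eq0.
  rewrite -!mxtrace_sigma_vecM -!so3_sigma_vec // !mulmxA.
  rewrite -(mulmxA _ (u^t*) u) unitarymxK //.
  by rewrite mulmx1 -(mulmxA u) mxtrace_conj.
apply/matrixP => i j; have := e (delta_mx i 0) (delta_mx j 0).
rewrite trmx_mul trmx_delta -colE -rowE mul_delta_mx_cond.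
move=> eij; transitivity ((delta_mx 0 0 *+ (i == j) : 'M[C]_1) 0 0).
  by rewrite -eij !mxE; apply: eq_bigr => k _; rewrite !mxE.
by case: (i == j) / eqP => [->|ij]; rewrite !mxE ?eqxx // (introF eqP ij).
Qed.

Lemma conj_sigma u i : u \is unitarymx ->
  u *m sigma C i *m u^t* = \sum_j so3 u j i *: sigma C j.
Proof.
move=> uU; have -> : sigma C i = sigma_vec (delta_mx i 0).
  rewrite /sigma_vec (bigD1 i) //= big1 ?addr0 => [|j ji]; rewrite mxE.
    by rewrite !eqxx scale1r.
  by rewrite (negPf ji) scale0r.
by rewrite so3_sigma_vec //; apply: eq_bigr => j _; rewrite -colE mxE.
Qed.

Lemma local_conj_tens u X Y :
  local_conj u (X *t Y) = (u *m X *m u^t*) *t (u *m Y *m u^t*).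
Proof. by rewrite /local_conj adj_tens !mxtens.tensmx_mul. Qed.

Lemma local_conj_pauli t c u : u \is unitarymx ->
  local_conj u (pauli t c) = pauli t (so3 u *m c *m (so3 u)^T).
Proof.
move=> uU; have -> : local_conj u (pauli t c)
    = t%:M + \sum_i \sum_j c i j *: local_conj u (sigma C i *t sigma C j).
  rewrite /local_conj mulmxDr mulmxDl mul_mx_scalar -scalemxAl.
  move/unitarymxP: (tensmx_unitary uU) => ->; rewrite scalemx1; congr (_ + _).
  rewrite mulmx_sumr mulmx_suml; apply: eq_bigr => i _.
  rewrite mulmx_sumr mulmx_suml; apply: eq_bigr => j _.
  by rewrite -scalemxAr -scalemxAl.
congr (_ + _); apply: eq_tensmx => x y a b.
transitivity (\sum_i \sum_j c i j * ((\sum_k so3 u k i * sigma C k x a)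
                                * \sum_k so3 u k j * sigma C k y b)).
  rewrite summxE; apply: eq_bigr => i _; rewrite summxE; apply: eq_bigr => j _.
  rewrite mxE local_conj_tens mxtens.tensmxE !conj_sigma // !summxE.
  by congr (_ * (_ * _)); apply: eq_bigr => k _; rewrite mxE.
transitivity (\sum_i \sum_j
    (so3 u *m c *m (so3 u)^T) i j * (sigma C i x a * sigma C j y b)).
  set O := so3 u; pose F k := sigma C k x a; pose G k := sigma C k y b.
  change (\sum_i \sum_j c i j * ((\sum_k O k i * F k) * \sum_k O k j * G k)
    = \sum_i \sum_j (O *m c *m O^T) i j * (F i * G j)).
  by clearbody O F G; rewrite !sum3 !mxE !sum3 !mxE !sum3; ring.
rewrite summxE; apply: eq_bigr => i _; rewrite summxE; apply: eq_bigr => j _.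
by rewrite [in RHS]mxE mxtens.tensmxE.
Qed.

(** A real vector is a traceless Hermitian matrix; a unitary diagonalising it
    sends it to a multiple of sigma_3. *)
Lemma rotate_to_e3 n : n != 0 -> conj_mx n = n ->
  exists2 u, u \is unitarymx &
    exists2 h, h != 0 & so3 u *m n = h *: delta_mx 2%:R 0.
Proof.
move=> n0 nreal.
have Hherm : (sigma_vec n)^t* = sigma_vec n.
  apply/matrixP => x y; rewrite 2!mxE !sigma_vecE rmorph_sum.
  apply: eq_bigr => i _.
  by rewrite rmorphM /= sigma_conj -[in RHS]nreal [in RHS]mxE.
have /orthomx_spectralP : sigma_vec n \is normalmx.
  by apply/normalmxP; rewrite Hherm.
set P := spectralmx _; set D := spectral_diag _ => HE.
have PU : P \is unitarymx by apply: spectral_unitarymx.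
exists P => //; pose h := D 0 0.
have DE : P *m sigma_vec n *m P^t* = diag_mx D.
  rewrite HE invmx_unitary // !mulmxA; move/unitarymxP: PU => PP.
  by rewrite PP mul1mx -mulmxA PP mulmx1.
have tr0 : D 0 0 + D 0 1 = 0.
  have := mxtrace_conj (sigma_vec n) PU.
  by rewrite DE mxtrace_sigma_vec mxtrace_diag sum2.
have dotr : sigma_vec (so3 P *m n) = sigma_vec (h *: delta_mx 2%:R 0).
  rewrite -so3_sigma_vec // DE; apply/matrixP => x y.
  rewrite sigma_vecE sum3 !mxE /=.
  move/eqP: tr0; rewrite addrC addr_eq0 => /eqP D1.
  case: (ord2P x) => ->; case: (ord2P y) => -> /=; rewrite ?D1 /h; ring.
have rn := can_inj sigma_vecK dotr.
exists h => //; apply: contraNneq n0 => h0; apply/eqP.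
by rewrite -[n]mul1mx -(so3_orthogonal PU) -mulmxA rn h0 scale0r mulmx0.
Qed.

End Rotation.

(** * Complex 3 x 3 matrices *)

Section Matrix3.
Variable C : numClosedFieldType.
Implicit Types (c M N : 'M[C]_3) (t s : C) (n : 'cV[C]_3).

Lemma det_mx22 (M : 'M[C]_2) : \det M = M 0 0 * M 1 1 - M 0 1 * M 1 0.
Proof.
rewrite (expand_det_row M 0) sum2 /cofactor !det_mx11 !mxE /= expr0 expr1.
have -> : lift 0 0 = 1 :> 'I_2 by apply: val_inj.
have -> : lift 1 0 = 0 :> 'I_2 by apply: val_inj.
by ring.
Qed.

Lemma det_cofmx c :
  \det c = c 0 0 * cofmx c 0 0 + c 0 1 * cofmx c 0 1
           + c 0 2%:R * cofmx c 0 2%:R.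
Proof.
have liftE : ((lift (0 : 'I_3) (0 : 'I_2) = 1)
  * (lift (0 : 'I_3) (1 : 'I_2) = 2%:R)
  * (lift (1 : 'I_3) (0 : 'I_2) = 0) * (lift (1 : 'I_3) (1 : 'I_2) = 2%:R)
  * (lift (2%:R : 'I_3) (0 : 'I_2) = 0)
  * (lift (2%:R : 'I_3) (1 : 'I_2) = 1))%type.
  by do ![split]; apply: val_inj.
rewrite (expand_det_row c 0) sum3 /cofactor !det_mx22 !mxE !ord3_addE !liftE /=.
by ring.
Qed.

Lemma mulmx_cofmx c : c *m (cofmx c)^T = (\det c)%:M.
Proof.
rewrite det_cofmx; apply/matrixP => i j; rewrite !(mxE, sum3).
by case: (ord3P i) => ->; case: (ord3P j) => ->;
  rewrite !ord3_addE /= ?(mulr1n, mulr0n); ring.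
Qed.

Lemma cofmx_mulmx c : (cofmx c)^T *m c = (\det c)%:M.
Proof.
rewrite det_cofmx; apply/matrixP => i j; rewrite !(mxE, sum3).
by case: (ord3P i) => ->; case: (ord3P j) => ->;
  rewrite !ord3_addE /= ?(mulr1n, mulr0n); ring.
Qed.

Lemma trmx_cofmx c : (cofmx c)^T = c *m c - \tr c *: c
  + ((\tr c ^+ 2 - \tr (c *m c)) / 2%:R)%:M.
Proof.
apply/matrixP => i j; rewrite /mxtrace !(mxE, sum3).
by case: (ord3P i) => ->; case: (ord3P j) => ->;
  rewrite !ord3_addE /= ?(mulr1n, mulr0n); field.
Qed.

Lemma cayley_hamilton3 c : c *m c *m c = \tr c *: (c *m c)
  - ((\tr c ^+ 2 - \tr (c *m c)) / 2%:R) *: c + (\det c)%:M.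
Proof.
rewrite -cofmx_mulmx trmx_cofmx mulmxDl mulmxBl mul_scalar_mx -scalemxAl.
by rewrite [RHS]addrC addrACA subrr addr0 subrK.
Qed.

Lemma cofmx0_minor c i j k l : cofmx c = 0 -> c i j * c k l = c i l * c k j.
Proof.
move=> c0.
have e p q : c (p + 1) (q + 1) * c (p + 2%:R) (q + 2%:R)
           = c (p + 1) (q + 2%:R) * c (p + 2%:R) (q + 1).
  by have /matrixP/(_ p q) := c0; rewrite !mxE => /subr0_eq.
have := ((e 0 0, e 0 1, e 0 2%:R), (e 1 0, e 1 1, e 1 2%:R),
  (e 2%:R 0, e 2%:R 1, e 2%:R 2%:R)).
rewrite !ord3_addE => -[[[[a b] d] [[f g] h]] [[o p] q]].
case: (ord3P i) => ->; case: (ord3P j) => ->; case: (ord3P k) => ->;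
  case: (ord3P l) => ->; try by ring.
all: match goal with
  | e : _ = _ |- _ => solve [by apply: etrans (etrans e _); ring
                           | by apply: etrans (etrans (esym e) _); ring]
  end.
Qed.

(** By normality the square of M M^* is M M^* M M^* = M M M^* M^*, which
    vanishes, so M M^* = 0. *)
Lemma normal_square0 (M : 'M[C]_3) :
  M *m M^t* = M^t* *m M -> M *m M = 0 -> M = 0.
Proof.
move=> nM M2; apply: sqnorm_mx_eq0.
have -> : M *m M^t* = 0; last by rewrite linear0.
apply: sqnorm_mx_eq0; rewrite adjCM trmxCK -!mulmxA.
by rewrite (mulmxA (M^t*) M) -nM -!mulmxA (mulmxA M M) M2 mul0mx linear0.
Qed.

(** The real part or the imaginary part of n is a nonzero null vector. *)
Lemma real_kernel m (M : 'M[C]_(m, 3)) n :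
  n != 0 -> M *m n = 0 -> M *m conj_mx n = 0 ->
  exists n', [/\ n' != 0, conj_mx n' = n' & M *m n' = 0].
Proof.
move=> n0 Mn Mcn.
have [sum0|sum0] := eqVneq (n + conj_mx n) 0; last first.
  exists (n + conj_mx n); split=> //; last by rewrite mulmxDr Mn Mcn addr0.
  by apply/matrixP => i j; rewrite !mxE rmorphD /= conjCK addrC.
exists ('i *: n); split.
- by rewrite scaler_eq0 negb_or n0 neq0Ci.
- apply/matrixP => i j; rewrite !mxE rmorphM /= conjCi.
  have /matrixP/(_ i j)/eqP := sum0; rewrite !mxE addrC addr_eq0 => /eqP ->.
  by rewrite mulrNN.
- by rewrite -scalemxAr Mn scaler0.
Qed.

End Matrix3.

(** * Invertible coefficient matrix: a common real eigenvector *)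

(** The combination of the entries of the Cayley-Hamilton equation (in m1, m2,
    m3, the entries of N, N^2, N^3, and d, that of the identity) with the
    quadratic equation of N, which eliminates N^2 and N^3. *)
Lemma trace_det_identity (C : numClosedFieldType) (t s D d m3 m2 m1 tr : C) :
  (t ^+ 3 - t * s + 2%:R * D) * t * m1
    - 2%:R * D * (t ^+ 3 - t * s + 2%:R * D) * d
  = 4%:R * (m3 - (s * m2 - (s ^+ 2 - tr) / 2%:R * m1 + D ^+ 2 * d))
    - (4%:R * m3 - (((s + t ^+ 2) ^+ 2 - 2%:R * (2%:R * t * D)) * m1
                    - (s + t ^+ 2) * (2%:R * t * D) * d))
    + 2%:R * s * (2%:R * m2 - ((s + t ^+ 2) * m1 - (2%:R * t * D) * d))
    + (2%:R * tr - ((s + t ^+ 2) * s - 3%:R * (2%:R * t * D))) * m1.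
Proof. by field. Qed.

Section Invertible.
Variable C : numClosedFieldType.
Variables (t : C) (c : 'M[C]_3).
Hypothesis detc : \det c != 0.
Hypothesis yb1 : 2%:R *: (c^T *m c *m c) - \tr (c^T *m c) *: c
  = t ^+ 2 *: c - (2%:R * t) *: cofmx c.
Hypothesis yb3 : cofmx c *m c = c *m cofmx c.
Hypothesis uni_l : c *m c^t* = conj_mx c *m c^T.
Hypothesis uni_r : c^t* *m c = c^T *m conj_mx c.

Let D := \det c.
Let N := c^T *m c.
Let s := \tr N.

Let cofT_l : c^T *m cofmx c = D%:M.
Proof. by rewrite -[c^T *m _]trmxK trmx_mul trmxK cofmx_mulmx tr_scalar_mx. Qed.

Let cofT_r : cofmx c *m c^T = D%:M.
Proof. by rewrite -[_ *m c^T]trmxK trmx_mul trmxK mulmx_cofmx tr_scalar_mx. Qed.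

Let two_neq0 : 2%:R != 0 :> C. Proof. by rewrite pnatr_eq0. Qed.

(** The products c^T K c c^T and c^T c K c^T agree since K commutes with c,
    and c^T K = K c^T = det c. *)
Lemma gramC : c *m c^T = N.
Proof.
apply: (scalerI detc); rewrite -/D -!mul_scalar_mx -{1}cofT_l -!mulmxA.
rewrite (mulmxA (cofmx c)) yb3 -!mulmxA cofT_r mulmxA.
by rewrite mul_mx_scalar mul_scalar_mx.
Qed.

Let N_sym : N^T = N. Proof. by rewrite trmx_mul trmxK. Qed.

Let detN : \det N = D ^+ 2. Proof. by rewrite det_mulmx det_tr. Qed.

(* The cubic Yang-Baxter relation multiplied on the right by c^T. *)
Let N_quadratic : 2%:R *: (N *m N) = (s + t ^+ 2) *: N - (2%:R * t * D)%:M.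
Proof.
have : (2%:R *: (N *m c) - s *: c) *m c^T
  = (t ^+ 2 *: c - (2%:R * t) *: cofmx c) *m c^T by rewrite -yb1.
rewrite !mulmxBl -!scalemxAl -(mulmxA N) gramC cofT_r => /eqP.
rewrite subr_eq => /eqP ->.
by rewrite scale_scalar_mx scalerDl [LHS]addrC addrA.
Qed.

Let scalar_inj (a b : C) : a%:M = b%:M :> 'M[C]_3 -> a = b.
Proof. by move/matrixP/(_ 0 0); rewrite !mxE eqxx. Qed.

Let scale_gram_scalar (a b : C) : a *: N = b%:M -> a != 0 -> N = (b / a)%:M.
Proof.
move=> e a0; apply: (scalerI a0); rewrite e scale_scalar_mx.
by rewrite mulrC divfK.
Qed.

Let tr_scalar (a : C) : N = a%:M -> s = 3%:R * a /\ D ^+ 2 = a ^+ 3.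
Proof.
by move=> e; rewrite -detN /s e mxtrace_scalar det_scalar mulr_natl.
Qed.

Lemma gram_t_neq0 : t != 0.
Proof.
apply/negP => /eqP t0; move: N_quadratic.
rewrite t0 !(mulr0, mul0r, expr0n) /= addr0 raddf0 subr0 => e.
have NU : N \in unitmx by rewrite unitmxE detN unitfE expf_neq0.
have eN : 2%:R *: N = s%:M.
  apply: (can_inj (mulmxK NU)); rewrite -scalemxAl e -mul_scalar_mx //.
have [es eD] := tr_scalar (scale_gram_scalar eN two_neq0).
have s0 : s = 0.
  have e3 : 2%:R * s = 3%:R * s by rewrite {1}es; field.
  by transitivity (3%:R * s - 2%:R * s); [ring | rewrite e3 subrr].
move/eqP: eD; rewrite s0 mul0r expr0n /= expf_eq0 /= => /eqP D0.
by case/negP: detc; apply/eqP.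
Qed.

(** If N has eigenvalues x, x, z with x <> z, then x + z = (s + t^2) / 2 and
    s = 2 x + z give z = t^2, and x z = t D gives the claim.  Without
    eigenvalues: reducing the Cayley-Hamilton equation of N by its quadratic
    equation gives e t N = 2 D e with e = t^3 - t s + 2 D.  If e were nonzero,
    N would be scalar, and the quadratic equation would give N = 0. *)
Lemma gram_trace_det : 2%:R * D = t * (s - t ^+ 2).
Proof.
set e := t ^+ 3 - t * s + 2%:R * D.
suff e0 : e = 0 by apply/subr0_eq; rewrite -e0 /e; ring.
pose a := s + t ^+ 2; pose b := 2%:R * t * D.
have N2 : 2%:R *: (N *m N) = a *: N - b%:M := N_quadratic.
have trN2 : 2%:R * \tr (N *m N) = a * s - 3%:R * b.
  by rewrite -mxtraceZ N2 linearB /= mxtraceZ mxtrace_scalar mulr_natl.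
have N3 : 4%:R *: (N *m N *m N) = (a ^+ 2 - 2%:R * b) *: N - (a * b)%:M.
  rewrite (_ : 4%:R = 2%:R * 2%:R :> C); last by ring.
  rewrite -scalerA scalemxAl N2 mulmxBl scalerBr -scalemxAl mul_scalar_mx.
  rewrite scalerA mulrC -scalerA N2 scalerBr scalerA scale_scalar_mx.
  by rewrite scalerA -expr2 scalerBl addrAC.
have eN : (e * t) *: N = (2%:R * D * e)%:M.
  have := cayley_hamilton3 N; rewrite -/s detN.
  move: N2 trN2 N3; set M3 := N *m N *m N; set M2 := N *m N.
  move=> N2 trN2 N3 CH; apply/matrixP => i j.
  have /(congr1 (fun X : 'M_3 => X i j)) := CH.
  move/(congr1 (fun X : 'M_3 => X i j)): N3.
  move/(congr1 (fun X : 'M_3 => X i j)): N2.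
  rewrite /M3 /M2 -/M2 -/M3; clearbody M3 M2 N.
  rewrite !mxE; pose d : C := (i == j)%:R.
  have dE x : x *+ (i == j) = x * d by rewrite mulr_natr.
  rewrite !dE => h2 h3 h1.
  apply: subr0_eq.
  transitivity (4%:R * (M3 i j
      - (s * M2 i j - (s ^+ 2 - \tr M2) / 2%:R * N i j + D ^+ 2 * d))
    - (4%:R * M3 i j - ((a ^+ 2 - 2%:R * b) * N i j - a * b * d))
    + 2%:R * s * (2%:R * M2 i j - (a * N i j - b * d))
    + (2%:R * \tr M2 - (a * s - 3%:R * b)) * N i j).
    exact: trace_det_identity.
  by rewrite -h1 -h2 -h3 -trN2 !subrr !(mulr0, mul0r) !(subr0, addr0).
apply/eqP; apply: contraT => e_neq0.
have et : e * t != 0 by rewrite mulf_neq0 // gram_t_neq0.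
have := scale_gram_scalar eN et.
have -> : 2%:R * D * e / (e * t) = 2%:R * D / t by field; rewrite gram_t_neq0.
set n := _ / _ => Nn; have [sn Dn] := tr_scalar Nn.
have Dt : 2%:R * D = t * n by rewrite /n; field; rewrite gram_t_neq0.
have : 2%:R * (n * n) = (s + t ^+ 2) * n - 2%:R * t * D.
  apply: scalar_inj; have := N_quadratic.
  by rewrite [in X in X -> _]Nn -scalar_mxM !scale_scalar_mx -raddfB /=.
rewrite sn => q; have n0 : n * n = 0.
  transitivity ((3%:R * n + t ^+ 2) * n - 2%:R * t * D - 2%:R * (n * n)
    + t * (2%:R * D - t * n)); first by ring.
  by rewrite q Dt !subrr mulr0 addr0.
case/negP: detc; move/eqP: n0; rewrite mulf_eq0 orbb => /eqP n0.
by move: Dt; rewrite n0 mulr0 => /eqP; rewrite mulf_eq0 (negPf two_neq0).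
Qed.

(* The second root of the quadratic equation of N. *)
Let alpha := D / t.

Lemma gram_trace : s = 2%:R * alpha + t ^+ 2.
Proof.
apply: (mulfI gram_t_neq0); transitivity (2%:R * D + t * t ^+ 2).
  by rewrite gram_trace_det; ring.
by rewrite /alpha; field; rewrite gram_t_neq0.
Qed.

Lemma gram_factor : (N - (t ^+ 2)%:M) *m (N - alpha%:M) = 0.
Proof.
apply: (scalerI two_neq0); rewrite scaler0 mulmxBl !mulmxBr -scalar_mxM.
rewrite mul_scalar_mx mul_mx_scalar !scalerBr N_quadratic gram_trace.
rewrite (_ : 2%:R * t * D = 2%:R * (t ^+ 2 * alpha)); last first.
  by rewrite /alpha; field; rewrite gram_t_neq0.
rewrite !scalerA scale_scalar_mx; move: N alpha => M b.
by apply/matrixP => i j; rewrite !mxE; ring.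
Qed.

Let P := c *m c^t*.

Lemma mulmx_conjN : N *m conj_mx N = P *m P.
Proof.
rewrite -{2}gramC map_mxM -[in LHS]gramC -!mulmxA.
by rewrite (mulmxA c^T) -uni_r !mulmxA.
Qed.

Lemma conjN_mulmx : conj_mx N *m N = P *m P.
Proof.
rewrite -[in LHS]gramC map_mxM -!mulmxA (mulmxA _ c) uni_r.
by rewrite !mulmxA -uni_l -!mulmxA -uni_l.
Qed.

(* N is symmetric, so its adjoint is its conjugate; both products with it are
   the square of P by the reality of c c^* and c^* c. *)
Let shift_normal (a : C) :
  (N - a%:M) *m (N - a%:M)^t* = (N - a%:M)^t* *m (N - a%:M).
Proof.
have -> : (N - a%:M)^t* = conj_mx N - (a^*)%:M.
  by rewrite adjCB N_sym tr_scalar_mx map_scalar_mx.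
rewrite !mulmxBl !mulmxBr mulmx_conjN conjN_mulmx -!scalar_mxM.
rewrite !mul_scalar_mx !mul_mx_scalar (mulrC a).
move: (P *m P) (conj_mx N) N => M1 M2 M3.
by rewrite !opprB addrACA [RHS]addrACA (addrC (- _)).
Qed.

(** A double root alpha = t^2 would make N - t^2 nilpotent, and it is normal. *)
Lemma gram_dichotomy : N = (t ^+ 2)%:M \/ alpha != t ^+ 2.
Proof.
have [a_t|] := eqVneq alpha (t ^+ 2); last by right.
left; apply: subr0_eq; apply: normal_square0; first exact: shift_normal.
by have := gram_factor; rewrite a_t.
Qed.

(** P is positive with P^2 = |t|^4, so P = |t|^2; comparing with c c^T = t^2,
    c is t times a real matrix, which is orthogonal of determinant 1 and so
    has the eigenvalue 1. *)
Lemma gram_axis_scalar : N = (t ^+ 2)%:M -> exists n : 'cV[C]_3,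
  [/\ n != 0, conj_mx n = n, c *m n = t *: n & c^T *m n = t *: n].
Proof.
move=> Nt; pose rho := t * t^*.
have PP : P *m P = (rho ^+ 2)%:M.
  rewrite -mulmx_conjN Nt map_scalar_mx -scalar_mxM; congr (_%:M).
  by rewrite /rho rmorphXn /=; ring.
pose X := P - rho%:M.
have Pherm : P^t* = P by rewrite adjCM trmxCK.
have Xherm : X^t* = X.
  rewrite adjCB Pherm tr_scalar_mx map_scalar_mx /= /rho rmorphM /= conjCK.
  by rewrite mulrC.
have rho_gt0 : 0 < rho by rewrite mul_conjC_gt0 gram_t_neq0.
have X0 : X *m P *m X + rho *: (X *m X) = 0.
  have : X *m (P + rho%:M) = 0.
    rewrite mulmxDr !mulmxBl PP -scalar_mxM mul_scalar_mx mul_mx_scalar -expr2.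
    by rewrite addrA subrK subrr.
  move/(congr1 (mulmx^~ X)); rewrite mul0mx mulmxDr mulmxDl mul_mx_scalar.
  by rewrite -scalemxAl.
have X00 : X = 0.
  apply: sqnorm_mx_eq0; rewrite Xherm.
  have := congr1 mxtrace X0; rewrite mxtraceD mxtraceZ mxtrace0 => tr0.
  have ge1 : 0 <= \tr (X *m P *m X).
    rewrite /P !mulmxA -{2}Xherm -mulmxA -adjCM; exact: sqnorm_mx_ge0.
  have ge2 : 0 <= \tr (X *m X) by rewrite -{2}Xherm; exact: sqnorm_mx_ge0.
  have ge3 := mulr_ge0 (ltW rho_gt0) ge2.
  move/eqP: tr0; rewrite (paddr_eq0 ge1 ge3).
  by rewrite mulf_eq0 (gt_eqF rho_gt0) => /andP[_ /eqP].
have cc : t *: conj_mx c = t^* *: c.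
  apply: (scalerI gram_t_neq0).
  rewrite !scalerA -/rho -expr2 -mul_mx_scalar -Nt.
  rewrite mulmxA -uni_l -/P; move/subr0_eq: X00 => ->.
  by rewrite mul_scalar_mx.
have Dt : D = t ^+ 3.
  have [sn _] := tr_scalar Nt; apply: (mulfI two_neq0).
  by rewrite gram_trace_det sn; ring.
(* The usual argument for rotations: c^T (c - t) = - t (c - t)^T, so that
   t^3 det (c - t) = - t^3 det (c - t). *)
have det0 : \det (c - t%:M)^T = 0.
  rewrite det_tr; have : c^T *m (c - t%:M) = (- t) *: (c - t%:M)^T.
    rewrite mulmxBr -/N Nt mul_mx_scalar linearB /= tr_scalar_mx scaleNr.
    by rewrite scalerBr scale_scalar_mx opprB -expr2.
  move/(congr1 determinant); rewrite det_mulmx !det_tr detZ det_tr -/D Dt => e.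
  have nz : 2%:R * t ^+ 3 != 0 :> C.
    by rewrite mulf_neq0 // expf_neq0 // gram_t_neq0.
  apply: (mulfI nz); rewrite mulr0.
  transitivity (t ^+ 3 * \det (c - t%:M) - (- t) ^+ 3 * \det (c - t%:M)).
    by ring.
  by rewrite e subrr.
have /det0P[v v0 vK] : \det (c - t%:M)^T == 0 by rewrite det0.
have yK : (c - t%:M) *m v^T = 0.
  by rewrite -[LHS]trmxK trmx_mul trmxK vK linear0.
have [||n [n0 nR nK]] := real_kernel (n := v^T) _ yK.
- by apply: contraNneq v0 => vT; rewrite -[v]trmxK vT linear0.
- have e : t^* *: (conj_mx v^T) = conj_mx c *m conj_mx v^T.
    move/eqP: yK; rewrite mulmxBl subr_eq0 mul_scalar_mx => /eqP yK.
    by rewrite -map_mxM yK map_mxZ.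
  have tc0 : t^* != 0 by rewrite conjC_eq0 gram_t_neq0.
  rewrite mulmxBl mul_scalar_mx; apply/(scalerI tc0).
  rewrite scalerBr scaler0 scalemxAl -cc -scalemxAl -e.
  by rewrite !scalerA mulrC subrr.
have cn : c *m n = t *: n.
  by move/eqP: nK; rewrite mulmxBl subr_eq0 mul_scalar_mx => /eqP.
exists n; split=> //; apply: (scalerI gram_t_neq0).
by rewrite scalemxAr -cn mulmxA -/N Nt mul_scalar_mx cn scalerA.
Qed.

(** M = N - alpha is delta times an idempotent of trace 1, so its cofactors
    vanish and it has rank one.  A nonzero column w of M is then an
    eigenvector of everything that commutes with M, in particular of c and of
    c^T.  As M is normal and symmetric, w is real up to a phase. *)
Lemma gram_axis_nonscalar : alpha != t ^+ 2 -> exists n : 'cV[C]_3, exists mu,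
  [/\ n != 0, conj_mx n = n, c *m n = mu *: n, c^T *m n = mu *: n
    & mu ^+ 2 = t ^+ 2].
Proof.
move=> alpha_t; pose M := N - alpha%:M; pose delta := t ^+ 2 - alpha.
have delta0 : delta != 0 by rewrite subr_eq0 eq_sym.
have trM : \tr M = delta.
  by rewrite linearB /= mxtrace_scalar -/s gram_trace /delta -mulr_natr; ring.
have NM : N *m M = t ^+ 2 *: M.
  by have /eqP := gram_factor; rewrite mulmxBl subr_eq0 mul_scalar_mx => /eqP.
have MM : M *m M = delta *: M.
  by rewrite {1}/M mulmxBl NM mul_scalar_mx scalerBl.
have M_sym : M^T = M by rewrite linearB /= N_sym tr_scalar_mx.
have rank1 i j k l : M i j * M k l = M i l * M k j.
  apply: cofmx0_minor; apply: trmx_inj; rewrite trmx_cofmx MM trM subrr.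
  by rewrite mxtraceZ trM -expr2 subrr mul0r raddf0 addr0 trmx0.
have symE i j : M i j = M j i by rewrite -{1}M_sym mxE.
have [k Mkk] : exists k, M k k != 0.
  apply/existsP; apply: contraT; rewrite negb_exists => /forallP M0.
  move: delta0; rewrite -trM /mxtrace big1 ?eqxx // => i _.
  by apply/eqP; have := M0 i; rewrite negbK.
pose w : 'cV[C]_3 := col k M.
have wE i : w i 0 = M i k by rewrite mxE.
have colM (X : 'M[C]_3) : X *m w = col k (X *m M) by rewrite /w !colE mulmxA.
have cM : c *m M = M *m c.
  rewrite mulmxBr mulmxBl mul_scalar_mx mul_mx_scalar; congr (_ - _).
  by rewrite {1}/N mulmxA gramC.
pose mu := (M *m c) k k / M k k.
have eigen (X : 'M[C]_3) : X *m M = M *m X ->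
    X *m w = ((M *m X) k k / M k k) *: w.
  move=> XM; apply/matrixP => i j; rewrite ord1.
  apply: (mulfI Mkk); transitivity ((M *m X) k k * M i k); last first.
    rewrite [(_ *: w) i 0]mxE wE; move: ((M *m X) k k) (M i k) => x y.
    by rewrite mulrA mulrCA mulfV ?mulr1.
  rewrite colM XM [col _ _ _ _]mxE [(M *m X) i k]mxE [(M *m X) k k]mxE.
  rewrite mulr_suml mulr_sumr; apply: eq_bigr => l _.
  by rewrite mulrA [M k k * _]mulrC rank1 [RHS]mulrC mulrA.
have cw : c *m w = mu *: w by apply: eigen.
have cTw : c^T *m w = mu *: w.
  have e : c^T *m M = M *m c^T.
    by rewrite -[LHS]trmxK trmx_mul trmxK M_sym -cM trmx_mul M_sym.
  rewrite eigen // /mu; congr (_ / _ *: _).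
  by rewrite -e -[c^T *m M]trmxK mxE trmx_mul trmxK M_sym.
have w0 : w k 0 != 0 by rewrite mxE.
have mu2 : mu ^+ 2 = t ^+ 2.
  have /matrixP/(_ k 0) : mu ^+ 2 *: w = t ^+ 2 *: w.
    transitivity (N *m w).
      by rewrite -mulmxA cw -scalemxAr cTw scalerA expr2.
    by rewrite colM NM; apply/matrixP => i j; rewrite !mxE.
  by rewrite [LHS]mxE [RHS]mxE => /(mulIf w0).
have normM := shift_normal alpha.
pose n : 'cV[C]_3 := (M k k)^* *: w.
exists n, mu; split=> //.
- rewrite scaler_eq0 negb_or conjC_eq0 Mkk /=.
  by apply: contraNneq w0 => ->; rewrite mxE.
- pose G i := (M *m conj_mx M) i k.
  have GM i : G i * M k k = M i k * G k.
    rewrite /G [(M *m _) i k]mxE [(M *m _) k k]mxE mulr_suml mulr_sumr.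
    apply: eq_bigr => j _.
    by rewrite mulrAC rank1 mulrA.
  (* G i is the entry (i, k) of M M^*, which is real since M M^* = M^* M is
     its own conjugate. *)
  have Greal i : (G i)^* = G i.
    have McE : M^t* = conj_mx M by rewrite M_sym.
    transitivity ((conj_mx (M *m conj_mx M)) i k); first by rewrite [RHS]mxE.
    have ccM : conj_mx (conj_mx M) = M.
      by apply/matrixP => x y; rewrite [LHS]mxE [X in X^*]mxE conjCK.
    by rewrite map_mxM ccM /G -McE normM.
  have G0 : G k != 0.
    have Mk_gt0 : 0 < `|M k k| ^+ 2 by rewrite exprn_gt0 // normr_gt0.
    rewrite gt_eqF // /G [(M *m _) k k]mxE (bigD1 k) //= ltr_wpDr //;
      last first.
      by rewrite [conj_mx M k k]mxE -normCK.
    apply: sumr_ge0 => j _; rewrite [conj_mx M j k]mxE (symE j k) -normCK.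
    by rewrite exprn_ge0.
  apply/matrixP => i j; rewrite ord1 {j} [LHS]mxE /n.
  rewrite [(_ *: w) i 0]mxE wE rmorphM /= conjCK.
  apply: (mulIf G0); rewrite mulrAC -mulrA [RHS]mulrAC -[RHS]mulrA.
  have e1 := GM i; have e2 : G i * (M k k)^* = (M i k)^* * G k.
    by rewrite -[in LHS]Greal -rmorphM e1 rmorphM /= Greal.
  by rewrite [in LHS](mulrC (G k)) -e2 [in RHS](mulrC (G k)) -e1; ring.
- by rewrite -scalemxAr cw !scalerA mulrC.
- by rewrite -scalemxAr cTw !scalerA mulrC.
Qed.

Lemma gram_axis : exists n : 'cV[C]_3, exists mu,
  [/\ n != 0, conj_mx n = n, c *m n = mu *: n, c^T *m n = mu *: n
    & mu ^+ 2 = t ^+ 2].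
Proof.
have [/gram_axis_scalar[n [n0 nR cn cTn]]|] := gram_dichotomy;
  last exact: gram_axis_nonscalar.
by exists n, t.
Qed.

End Invertible.

(** * Invertible and rank two coefficient matrices *)

Section Cases.
Variable C : numClosedFieldType.
Implicit Types (u : 'M[C]_2) (c : 'M[C]_3) (t : C).

Section Facts.
Variables (t : C) (c : 'M[C]_3).
Hypothesis RA : unitary_Rmatrix (pauli t c).

Lemma pauli_unitary_inv : pauli t c *m pauli t^* (conj_mx c) = 1%:M.
Proof. by rewrite -pauli_adj; apply/unitarymxP; case: RA. Qed.

Lemma pauli_gram_l : c *m c^t* = conj_mx c *m c^T.
Proof.
have := pauli_inv_syml pauli_unitary_inv.
by rewrite trmx_mul trmxK => ->; rewrite map_trmx.
Qed.

Lemma pauli_gram_r : c^t* *m c = c^T *m conj_mx c.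
Proof.
have := pauli_inv_symr pauli_unitary_inv.
by rewrite trmx_mul trmxK map_trmx => ->.
Qed.

End Facts.

(** The 2 x 2 matrix X with rows (a, b) and (g, h) satisfies X^T X = nu, so
    det X . X^T = nu . adj X, and (nu / det X)^2 = 1. *)
Lemma conformal2 (a b g h nu : C) : a * h - b * g != 0 ->
  a ^+ 2 + g ^+ 2 = nu -> b ^+ 2 + h ^+ 2 = nu -> a * b + g * h = 0 ->
  exists k, [/\ k ^+ 2 = 1, h = k * a & g = - k * b].
Proof.
set D := a * h - b * g => D0 aE bE abE.
have aD : a * D = nu * h.
  apply: subr0_eq.
  transitivity (- g * (a * b + g * h) + (a ^+ 2 + g ^+ 2 - nu) * h).
    by rewrite /D; ring.
  by rewrite abE aE; ring.
have hD : h * D = nu * a.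
  apply: subr0_eq.
  transitivity (- b * (a * b + g * h) + (b ^+ 2 + h ^+ 2 - nu) * a).
    by rewrite /D; ring.
  by rewrite abE bE; ring.
have gD : g * D = - nu * b.
  apply: subr0_eq.
  transitivity (a * (a * b + g * h) - (a ^+ 2 + g ^+ 2 - nu) * b).
    by rewrite /D; ring.
  by rewrite abE aE; ring.
have bD : b * D = - nu * g.
  apply: subr0_eq.
  transitivity (h * (a * b + g * h) - (b ^+ 2 + h ^+ 2 - nu) * g).
    by rewrite /D; ring.
  by rewrite abE bE; ring.
have nuD : nu ^+ 2 = D ^+ 2.
  apply: (mulfI D0); apply: subr0_eq.
  transitivity (a * (nu * (nu * h - a * D) + D * (nu * a - h * D))
    + b * (nu * (- nu * g - b * D) - D * (- nu * b - g * D))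
    + (nu * nu - D * D) * (D - (a * h - b * g))).
    by rewrite /D; ring.
  by rewrite aD hD gD bD /D; ring.
exists (nu / D); split.
- by rewrite expr_div_n nuD divff // expf_neq0.
- by apply: (mulIf D0); rewrite hD; field.
- by apply: (mulIf D0); rewrite gD; field.
Qed.

Definition block3 c :=
  [/\ c 0 2%:R = 0, c 1 2%:R = 0, c 2%:R 0 = 0 & c 2%:R 1 = 0].

(** The upper 2 x 2 block of N is alpha times the identity: its eigenvalues
    are among t^2 and alpha, and its trace is 2 alpha.  So the block of c is
    conformal, with a sign k, and alpha t = det c forces mu = k t. *)
Lemma block_representative t c : unitary_Rmatrix (pauli t c) ->
  \det c != 0 -> block3 c -> c 2%:R 2%:R ^+ 2 = t ^+ 2 ->
  representative (pauli t c).
Proof.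
move=> RA det0 [c02 c12 c20 c21] mu2; have [AU YB] := RA.
have [y1 y3] := (pauli_yb_cubic YB, pauli_yb_cofmx YB).
have [gl gr] := (pauli_gram_l RA, pauli_gram_r RA).
have t0 := gram_t_neq0 det0 y1 y3.
have fN := gram_factor det0 y1 y3.
have sN := gram_trace det0 y1 y3.
have dN := gram_dichotomy det0 y1 y3 gl gr.
have detE : \det c = c 2%:R 2%:R * (c 0 0 * c 1 1 - c 0 1 * c 1 0).
  by rewrite det_cofmx !mxE !ord3_addE c02 c12 c20 c21; ring.
set alpha := \det c / t in fN sN dN.
have alpha0 : alpha != 0 by rewrite mulf_neq0 // invr_eq0.
have alphaE : alpha * t = \det c by rewrite /alpha divfK.
move: detE alphaE fN sN dN; clearbody alpha.
set a := c 0 0; set b := c 0 1; set g := c 1 0; set h := c 1 1.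
set mu := c 2%:R 2%:R in mu2 *.
move=> detE alphaE.
set N := c^T *m c; pose x := a ^+ 2 + g ^+ 2; pose y := a * b + g * h.
pose z := b ^+ 2 + h ^+ 2.
have N00 : N 0 0 = x by rewrite mxE sum3 !mxE c20 -/a -/g /x; ring.
have N01 : N 0 1 = y by rewrite mxE sum3 !mxE c20 -/a -/b -/g -/h /y; ring.
have N10 : N 1 0 = y by rewrite mxE sum3 !mxE c20 -/a -/b -/g -/h /y; ring.
have N11 : N 1 1 = z by rewrite mxE sum3 !mxE c21 -/b -/h /z; ring.
have N02 : N 0 2%:R = 0 by rewrite mxE sum3 !mxE c20 c02 c12; ring.
have N12 : N 1 2%:R = 0 by rewrite mxE sum3 !mxE c21 c02 c12; ring.
have N22 : N 2%:R 2%:R = t ^+ 2.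
  by rewrite mxE sum3 !mxE c02 c12 -/mu -mu2; ring.
move=> fN sN dN.
have subE i j (w : C) : (N - w%:M) i j = N i j - w *+ (i == j).
  by rewrite [LHS]mxE [X in _ + X]mxE [X in _ - X]mxE.
have [xE [yE zE]] : x = alpha /\ (y = 0 /\ z = alpha).
  move: sN; rewrite /mxtrace sum3 N00 N11 N22 => /addIr sN.
  have zE : z = 2%:R * alpha - x by rewrite -sN; ring.
  case: dN => [Nt | alpha_t].
    have e00 : x = t ^+ 2 by rewrite -N00 Nt !mxE.
    have e01 : y = 0 by rewrite -N01 Nt !mxE.
    have e11 : z = t ^+ 2 by rewrite -N11 Nt !mxE.
    have ea : alpha = t ^+ 2.
      apply: (mulfI (_ : 2%:R != 0 :> C)); first by rewrite pnatr_eq0.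
      by rewrite -sN e00 e11; ring.
    by rewrite e00 e01 e11 ea.
  have f00 : (x - t ^+ 2) * (x - alpha) + y * y = 0.
    have /matrixP/(_ 0 0) := fN; rewrite mxE sum3 [in RHS]mxE => <-.
    rewrite !subE N00 N01 N10 N02 /=.
    by rewrite ?mulr1n ?mulr0n; ring.
  have f11 : (z - t ^+ 2) * (z - alpha) + y * y = 0.
    have /matrixP/(_ 1 1) := fN; rewrite mxE sum3 [in RHS]mxE => <-.
    rewrite !subE N11 N01 N10 N12 /=.
    by rewrite ?mulr1n ?mulr0n; ring.
  have f01 : (x - t ^+ 2) * y + y * (z - alpha) = 0.
    have /matrixP/(_ 0 1) := fN; rewrite mxE sum3 [in RHS]mxE => <-.
    rewrite !subE N00 N01 N11 N02 /=.
    by rewrite ?mulr1n ?mulr0n; ring.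
  have d0 : alpha - t ^+ 2 != 0 by rewrite subr_eq0.
  have y0 : y = 0.
    by apply: (mulfI d0); rewrite mulr0 -f01 zE; ring.
  have xE : x = alpha.
    apply: subr0_eq; apply: (mulfI d0); apply: (mulfI (_ : 2%:R != 0 :> C)).
      by rewrite pnatr_eq0.
    transitivity (((x - t ^+ 2) * (x - alpha) + y * y)
                  - ((z - t ^+ 2) * (z - alpha) + y * y)).
      by rewrite zE; ring.
    by rewrite f00 f11; ring.
  by rewrite zE y0 xE; split=> //; split=> //; ring.
have D0 : a * h - b * g != 0.
  by apply: contraNneq det0 => D0; rewrite detE D0 mulr0.
have [k [k2 hE gE]] := conformal2 D0 xE zE yE.
have muE : mu = k * t.
  apply: (mulfI alpha0); rewrite mulrCA alphaE detE -[in LHS]xE /x gE hE.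
  by ring: k2.
have /orP[/eqP k1|/eqP kN1] : (k == 1) || (k == -1) by rewrite -sqrf_eq1 k2.
  apply: representative_R2 => // x1 y1' a1 b1.
  rewrite pauliE /pauli_entry c02 c12 c20 c21 -/a -/b -/g -/h -/mu.
  rewrite hE gE muE k1.
  case: (ord2P x1) => ->; case: (ord2P y1') => ->; case: (ord2P a1) => ->;
    case: (ord2P b1) => -> //= _; ring.
apply: representative_R3 => //.
  move=> x1 y1' a1 b1.
  rewrite pauliE /pauli_entry c02 c12 c20 c21 -/a -/b -/g -/h -/mu.
  rewrite hE gE muE kN1.
  case: (ord2P x1) => ->; case: (ord2P y1') => ->; case: (ord2P a1) => ->;
    case: (ord2P b1) => -> //= _; ring.
by rewrite !pauliE.
Qed.

(** If u rotates n to the third axis, an eigenvector n of c becomes the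
    eigenvector e_3 of the rotated matrix. *)
Lemma so3_eigen u c (n : 'cV[C]_3) (h mu : C) : u \is unitarymx -> h != 0 ->
  so3 u *m n = h *: delta_mx 2%:R 0 -> c *m n = mu *: n ->
  so3 u *m c *m (so3 u)^T *m delta_mx 2%:R 0 = mu *: delta_mx 2%:R 0 :> 'cV_3.
Proof.
move=> uU h0 un cn; apply: (scalerI h0).
rewrite scalemxAr -un scalerA mulrC -scalerA -un !mulmxA.
by rewrite -(mulmxA _ _ (so3 u)) so3_orthogonal // mulmx1 -mulmxA cn scalemxAr.
Qed.

Lemma invertible_classified t c : unitary_Rmatrix (pauli t c) ->
  \det c != 0 -> classified (pauli t c).
Proof.
move=> RA det0; have [AU YB] := RA.
have [n [mu [n0 nR cn cTn mu2]]] := gram_axis det0 (pauli_yb_cubic YB)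
  (pauli_yb_cofmx YB) (pauli_gram_l RA) (pauli_gram_r RA).
have [u uU [h h0 un]] := rotate_to_e3 n0 nR.
apply: (classified_conj uU); apply: classified_representative.
have := Rmatrix_conj uU RA; rewrite local_conj_pauli //.
set c' := so3 u *m c *m (so3 u)^T => RA'.
have ce : c' *m delta_mx 2%:R 0 = mu *: delta_mx 2%:R 0 :> 'cV_3.
  exact: so3_eigen h0 un cn.
have cTe : c'^T *m delta_mx 2%:R 0 = mu *: delta_mx 2%:R 0 :> 'cV_3.
  by rewrite /c' !trmx_mul trmxK mulmxA; apply: so3_eigen h0 un cTn.
have cE i : c' i 2%:R = mu * (i == 2%:R)%:R.
  by have /matrixP/(_ i 0) := ce; rewrite -colE !mxE andbT.
have cTE i : c' 2%:R i = mu * (i == 2%:R)%:R.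
  by have /matrixP/(_ i 0) := cTe; rewrite -colE !mxE andbT.
apply: block_representative => //.
- have detO : \det (so3 u) * \det (so3 u) = 1.
    by rewrite -{1}det_tr -det_mulmx so3_orthogonal // det1.
  by rewrite /c' !det_mulmx det_tr mulrAC detO mul1r.
- by split; rewrite ?cE ?cTE /= mulr0.
- by rewrite cE eqxx mulr1.
Qed.

(** The rows of K are null vectors of c, and their conjugates are as well
    since c^* c is real. *)
Lemma singular_real_kernel t c : unitary_Rmatrix (pauli t c) -> \det c = 0 ->
  cofmx c != 0 -> exists n : 'cV[C]_3, [/\ n != 0, conj_mx n = n & c *m n = 0].
Proof.
move=> RA det0 K0.
have [i Ki] : exists i, row i (cofmx c) != 0.
  apply/existsP; apply: contraT; rewrite negb_exists => /forallP K00.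
  case/negP: K0; apply/eqP/row_matrixP => i; rewrite row0.
  by apply/eqP; have := K00 i; rewrite negbK.
pose y := (row i (cofmx c))^T.
have cy : c *m y = 0.
  by rewrite /y tr_row colE mulmxA mulmx_cofmx det0 raddf0 mul0mx.
apply: (real_kernel (n := y)) => //.
  by apply: contraNneq Ki => y0; rewrite -[row _ _]trmxK -/y y0 trmx0.
have : (c *m conj_mx y)^t* = 0.
  apply: sqnorm_mx_eq0; rewrite trmxCK adjCM -mulmxA (mulmxA (c^t*)).
  rewrite (pauli_gram_r RA).
  by rewrite -(mulmxA c^T) -map_mxM cy map_mx0 !mulmx0 linear0.
by move/(congr1 (fun X : 'M_(1, 3) => X^t*)); rewrite trmxCK trmx0 map_mx0.
Qed.

(** Only the last column of K can be nonzero.  If it is, the last column of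
    the cubic relation gives t = 0, and K c = c K clears the last row of c.
    The 2 x 2 block of c is then conformal with rows (a, b) and (- k b, k a),
    and unitarity reads crossmx c (conj c) = 0, whose corner entry is
    2 k (|a|^2 + |b|^2). *)
Lemma kernel_e3_rank1 t c : unitary_Rmatrix (pauli t c) ->
  c *m delta_mx 2%:R 0 = 0 :> 'cV_3 -> cofmx c = 0.
Proof.
move=> RA ce; have [AU YB] := RA.
have c2 i : c i 2%:R = 0.
  by have /matrixP/(_ i 0) := ce; rewrite -colE !mxE.
have K0 i : cofmx c i 0 = 0 by rewrite mxE !ord3_addE !c2; ring.
have K1 i : cofmx c i 1 = 0 by rewrite mxE !ord3_addE !c2; ring.
suff K2 i : cofmx c i 2%:R = 0.
  by apply/matrixP => i j; rewrite [RHS]mxE; case: (ord3P j) => ->.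
apply/eqP; apply: contraT => Ki.
have t0 : t = 0.
  have /matrixP/(_ i 2%:R) := pauli_yb_cubic YB.
  move: (cofmx c) Ki => K Ki.
  rewrite !mxE !sum3 !c2 !(mulr0, addr0, subr0) sub0r => /eqP.
  by rewrite eq_sym oppr_eq0 !mulf_eq0 (negPf Ki) pnatr_eq0 orbF => /eqP.
have row2 j : j != 2%:R -> c 2%:R j = 0.
  move=> j2; have /matrixP/(_ i j) := pauli_yb_cofmx YB.
  rewrite mxE [in RHS]mxE !sum3 K0 K1 !mul0r !add0r => e.
  apply: (mulfI Ki); rewrite mulr0 e.
  by case: (ord3P j) j2 => ->; rewrite ?eqxx // ?K0 ?K1 !mulr0 !addr0.
have [c20 c21] : c 2%:R 0 = 0 /\ c 2%:R 1 = 0 by split; apply: row2.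
have i2 : i = 2%:R.
  apply/eqP; apply: contraT => i2; case/negP: Ki; apply/eqP.
  by case: (ord3P i) i2 => ->; rewrite ?eqxx // => _;
    rewrite mxE !ord3_addE c20 c21; ring.
move: Ki; rewrite i2 mxE !ord3_addE.
set a := c 0 0; set b := c 0 1; set g := c 1 0; set h := c 1 1 => D0.

pose x := a ^+ 2 + g ^+ 2; pose y := a * b + g * h; pose z := b ^+ 2 + h ^+ 2.
have e i' j' : 2%:R * (c^T *m c *m c) i' j' = (x + z) * c i' j'.
  have /matrixP/(_ i' j') := pauli_yb_cubic YB.
  rewrite t0 mulr0 scale0r subr0 expr0n scale0r [RHS]mxE.
  rewrite [LHS]mxE [X in _ + X]mxE [X in X + _]mxE [X in _ - X]mxE.
  move/subr0_eq => ->; congr (_ * _).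
  by rewrite /mxtrace sum3 !mxE !sum3 !mxE c20 c21 !c2 /x /z /a /b /g /h; ring.
have NcE (i' j' : 'I_3) : (c^T *m c *m c) i' j'
    = \sum_l (\sum_k c k i' * c k l) * c l j'.
  rewrite mxE; apply: eq_bigr => l _; rewrite mxE; congr (_ * _).
  by apply: eq_bigr => k _; rewrite mxE.
have := (e 0 0, e 0 1, (e 1 0, e 1 1)); rewrite !NcE !sum3 c20 c21 !c2.
rewrite -/a -/b -/g -/h => -[[e00 e01] [e10 e11]].
have D2 : 2%:R * (a * h - b * g) != 0 by rewrite mulf_neq0 // pnatr_eq0.
have yE : y = 0.
  apply: (mulfI D2); apply: subr0_eq.
  transitivity (a * (2%:R * (x * b + y * h)) - b * (2%:R * (x * a + y * g))).
    by ring.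
  rewrite (_ : 2%:R * (x * b + y * h) = (x + z) * b); last first.
    by rewrite -e01 /x /y; ring.
  rewrite (_ : 2%:R * (x * a + y * g) = (x + z) * a); last first.
    by rewrite -e00 /x /y; ring.
  by ring.
have zE : z = x.
  apply: (mulfI D0); apply: subr0_eq.
  transitivity ((a * (2%:R * (y * b + z * h)) - b * (2%:R * (y * a + z * g)))
    - (x + z) * (a * h - b * g)); first by ring.
  rewrite (_ : 2%:R * (y * b + z * h) = (x + z) * h); last first.
    by rewrite -e11 /z /y; ring.
  rewrite (_ : 2%:R * (y * a + z * g) = (x + z) * g); last first.
    by rewrite -e10 /z /y; ring.
  by ring.
have [k [k2 hE gE]] := conformal2 D0 (erefl x) zE yE.
have kR : k^* = k.
  have /orP[/eqP ->|/eqP ->] : (k == 1) || (k == -1) by rewrite -sqrf_eq1 k2.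
    by rewrite conjC1.
  by rewrite rmorphN /= conjC1.
have k0 : 2%:R * k != 0.
  rewrite mulf_neq0 ?pnatr_eq0 //; apply/eqP => kk; move/eqP: k2.
  by rewrite kk expr0n eq_sym oner_eq0.
have ab0 : `|a| ^+ 2 + `|b| ^+ 2 = 0.
  have /matrixP/(_ 2%:R 2%:R) := pauli_inv_cross (pauli_unitary_inv RA).
  rewrite t0 conjC0 !scale0r addr0 [LHS]mxE [RHS]mxE !ord3_addE.
  rewrite ![conj_mx c _ _]mxE.
  rewrite -/a -/b -/g -/h hE gE !rmorphM rmorphN /= kR => ab.
  apply: (mulfI k0); rewrite mulr0 [RHS]ab !normCK; ring.
move: D0; rewrite hE gE; move/eqP: ab0; rewrite paddr_eq0 ?exprn_ge0 //.
rewrite !expf_eq0 !normr_eq0 /= => /andP[/eqP -> /eqP ->].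
by rewrite !mul0r subrr eqxx.
Qed.

End Cases.

(** * Coefficient matrices of rank at most one *)

Section RankOne.
Variable C : numClosedFieldType.
Implicit Types (u : 'M[C]_2) (c : 'M[C]_3) (t : C).

Lemma local_conjE u (B : 'M[C]_(2 * 2)) x y a b :
  local_conj u B (idx x y) (idx a b)
  = \sum_x' \sum_y' \sum_a' \sum_b' u x x' * u y y'
      * B (idx x' y') (idx a' b') * ((u a a')^* * (u b b')^*).
Proof.
rewrite /local_conj adj_tens mxE sum_tens.
under eq_bigr => a' _ do
  under eq_bigr => b' _ do rewrite mxE sum_tens mulr_suml.
under eq_bigr => a' _ do rewrite exchange_big.
rewrite exchange_big; apply: eq_bigr => x' _.
under eq_bigr => a' _ do under eq_bigr => b' _ do rewrite mulr_suml.
under eq_bigr => a' _ do rewrite exchange_big.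
rewrite exchange_big; apply: eq_bigr => y' _.
apply: eq_bigr => a' _; apply: eq_bigr => b' _.
by rewrite !mxtens.tensmxE !mxE.
Qed.

(** Here A = t + sigma_3 (x) Y with Y = sum_j y_j sigma_j.  The cubic relation
    gives y_3 = 0, since otherwise y_3 = t or y_3 = - t and A would be singular,
    and then y_1^2 + y_2^2 = - t^2.  With unitarity Y becomes antidiagonal with
    entries t w and - t / w where |w| = 1, and a diagonal conjugation removes
    the phase w. *)
Lemma row3_classified t (y : 'cV[C]_3) :
  unitary_Rmatrix (pauli t (delta_mx 2%:R 0 *m y^T)) -> y != 0 ->
  classified (pauli t (delta_mx 2%:R 0 *m y^T)).
Proof.
set c := _ *m _ => RA y_neq0; have [AU YB] := RA.
have cE i j : c i j = (i == 2%:R)%:R * y j 0.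
  by rewrite mxE big_ord1 !mxE eqxx andbT.
clearbody c.
have K0 : cofmx c = 0.
  by apply/matrixP => i j; rewrite !mxE !cE; case: (ord3P i) => ->;
    rewrite !ord3_addE /=; ring.
have crossE j : t * (y j 0)^* + t^* * y j 0 = 0.
  have /matrixP/(_ 2%:R j) := pauli_inv_cross (pauli_unitary_inv RA).
  rewrite mxE [X in X + _]mxE [X in _ + X]mxE [conj_mx c _ _]mxE.
  rewrite !cE eqxx !mul1r.
  by move=> ->; rewrite mxE !ord3_addE ![conj_mx c _ _]mxE !cE /=; ring.
have normE : t * t^* + (y 0 0 * (y 0 0)^* + y 1 0 * (y 1 0)^*
                        + y 2%:R 0 * (y 2%:R 0)^*) = 1.
  have := pauli_inv_norm (pauli_unitary_inv RA).
  rewrite /mxtrace sum3 !mxE !sum3 ![(conj_mx c)^T _ _]mxE.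
  rewrite ![conj_mx c _ _]mxE !cE.
  by rewrite /= !mul0r !mul1r !addr0 !add0r.
have gramE i j : (y i 0)^* * y j 0 = y i 0 * (y j 0)^*.
  have /matrixP/(_ i j) := pauli_gram_r RA.
  rewrite mxE [RHS]mxE !sum3 ![(c^t*) _ _]mxE ![c^T _ _]mxE.
  rewrite ![conj_mx c _ _]mxE !cE.
  by rewrite /= !(mul0r, mul1r, conjC0, add0r).
have Nc i j : (c^T *m c *m c) i j = y i 0 * y 2%:R 0 * y j 0.
  by rewrite mxE sum3 !mxE !sum3 !mxE !cE /=; ring.
have trN : \tr (c^T *m c) = y 0 0 ^+ 2 + y 1 0 ^+ 2 + y 2%:R 0 ^+ 2.
  by rewrite /mxtrace sum3 !mxE !sum3 !mxE !cE /=; ring.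
have yb i j : 2%:R * (y i 0 * y 2%:R 0 * y j 0)
    = (y 0 0 ^+ 2 + y 1 0 ^+ 2 + y 2%:R 0 ^+ 2 + t ^+ 2)
      * ((i == 2%:R)%:R * y j 0).
  have /matrixP/(_ i j) := pauli_yb_cubic YB; rewrite K0 scaler0 subr0.
  rewrite [LHS]mxE [X in _ + X]mxE [X in X + _]mxE [X in _ - X]mxE [RHS]mxE.
  by rewrite Nc trN cE => /eqP; rewrite subr_eq => /eqP ->; ring.
have y2 : y 2%:R 0 = 0.
  apply/eqP; apply: contraT => y2.
  have yi i : i != 2%:R -> y i 0 = 0.
    move=> i2; have := yb i 2%:R; rewrite (negPf i2) mul0r mulr0 => /eqP.
    by rewrite !mulf_eq0 pnatr_eq0 (negPf y2) !orbF => /eqP.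
  have [y0 y1] : y 0 0 = 0 /\ y 1 0 = 0 by split; apply: yi.
  have sq : y 2%:R 0 ^+ 2 = t ^+ 2.
    apply: (mulIf y2); apply: subr0_eq.
    transitivity (2%:R * (y 2%:R 0 * y 2%:R 0 * y 2%:R 0)
      - (y 0 0 ^+ 2 + y 1 0 ^+ 2 + y 2%:R 0 ^+ 2 + t ^+ 2)
        * ((2%:R == 2%:R :> 'I_3)%:R * y 2%:R 0)).
      by rewrite eqxx y0 y1 /=; ring.
    by rewrite yb subrr.
  have tt0 : t * t^* = 0 -> false.
    move/eqP; rewrite mul_conjC_eq0 => /eqP t0 /=.
    by move/eqP: sq; rewrite t0 expr0n expf_eq0 /= (negPf y2).
  move/eqP: sq; rewrite eqf_sqr => /orP[] /eqP y2E; apply: tt0;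
    have := crossE 2%:R; rewrite y2E ?rmorphN /= => e;
    apply: (mulfI (_ : 2%:R != 0 :> C));
    rewrite ?pnatr_eq0 // mulr0.
    by rewrite -e; ring.
  by rewrite -[RHS]oppr0 -e; ring.
move: yb normE gramE crossE; set p := y 0 0; set r := y 1 0.
move=> yb normE gramE crossE.
have pr : p ^+ 2 + r ^+ 2 = - t ^+ 2.
  have [j yj] : exists j, y j 0 != 0.
    apply/existsP; apply: contraT; rewrite negb_exists => /forallP Y0.
    case/negP: y_neq0; apply/eqP/matrixP => j k; rewrite ord1 mxE.
    by apply/eqP; have := Y0 j; rewrite negbK.
  apply: (mulIf yj); apply: subr0_eq.
  transitivity ((p ^+ 2 + r ^+ 2 + y 2%:R 0 ^+ 2 + t ^+ 2)
     * ((2%:R == 2%:R :> 'I_3)%:R * y j 0)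
    - 2%:R * (y 2%:R 0 * y 2%:R 0 * y j 0)).
    by rewrite eqxx y2 /=; ring.
  by rewrite yb subrr.
move: normE; rewrite y2 mul0r addr0 => normE.
have t0 : t != 0.
  apply/eqP => t0; have p0 : p = 0.
    transitivity (p * (t * t^* + (p * p^* + r * r^*))).
      by rewrite normE mulr1.
    transitivity (p^* * (p ^+ 2 + r ^+ 2) + r * (p * r^* - p^* * r)).
      by rewrite t0; ring.
    by rewrite pr -gramE t0 subrr; ring.
  move: pr normE; rewrite t0 p0 expr0n /= oppr0 add0r => /eqP.
  rewrite expf_eq0 /= => /eqP ->; rewrite !mul0r !addr0 => /eqP.
  by rewrite eq_sym oner_eq0.
have tc0 : t^* != 0 by rewrite conjC_eq0.
have pc : p^* = - t^* * p / t.
  by apply: (mulfI t0); apply: subr0_eq; rewrite -(crossE 0) -/p; field.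
have rc : r^* = - t^* * r / t.
  by apply: (mulfI t0); apply: subr0_eq; rewrite -(crossE 1) -/r; field.
pose w := (p - 'i * r) / t; pose w' := - (p + 'i * r) / t.
have wc : w^* = w'.
  rewrite /w rmorphM fmorphV rmorphB rmorphM /= conjCi pc rc /w'; field.
  by rewrite t0 tc0.
have ww : w * w' = 1.
  transitivity (- (p ^+ 2 + r ^+ 2) / t ^+ 2).
    by rewrite /w /w'; field: (sqrCi C).
  by rewrite pr opprK divff // expf_neq0.
have w'c : w'^* = w by rewrite -wc conjCK.
have pE : p = t * (w - w') / 2%:R by rewrite /w /w'; field.
have rE : r = 'i * t * (w + w') / 2%:R by rewrite /w /w'; field: (sqrCi C).
have tt : 2%:R * (t * t^*) = 1.
  rewrite -[RHS]normE pc rc.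
  transitivity (t * t^* - t^* / t * (p ^+ 2 + r ^+ 2)).
    by rewrite pr; field.
  by field.
pose v : 'M[C]_2 := diag_mx (\row_j if val j == 0%N then 1 else w').
have vU : v \is unitarymx.
  apply/unitarymxP/matrixP => i j; rewrite mxE sum2 !mxE.
  case: (ord2P i) => ->; case: (ord2P j) => -> /=;
    rewrite ?(mulr1n, mulr0n, conjC0, conjC1, w'c); ring: ww.
pose q := t * sqrtC 2%:R.
have s2 : sqrtC 2%:R != 0 :> C by rewrite sqrtC_eq0 pnatr_eq0.
exists v, (R4 q); split=> //.
  constructor; apply/eqP; rewrite -(@pexpr_eq1 _ _ 2) //; apply/eqP.
  have s_ge0 : 0 <= sqrtC 2%:R :> C by rewrite sqrtC_ge0 ler0n.
  rewrite normCK /q rmorphM /= (CrealP (ger0_real s_ge0)) mulrACA.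
  by rewrite -(expr2 (sqrtC _)) sqrtCK mulrC.
apply: eq_tensmx => x y' a b; rewrite pauliE local_conjE !sum2 /R4.
rewrite /q mulfK // /pauli_entry !cE -/p -/r y2 !mxE.
by case: (ord2P x) => ->; case: (ord2P y') => ->; case: (ord2P a) => ->;
  case: (ord2P b) => -> /=;
  rewrite ?(mulr1n, mulr0n, conjC0, conjC1, w'c) ?pE ?rE;
  clearbody w w'; field: (sqrCi C) ww.
Qed.

(** A nonzero c of rank one is x y^T where x is a column of the real matrix
    c c^*. *)
Lemma cofmx0_classified t c : unitary_Rmatrix (pauli t c) ->
  cofmx c = 0 -> classified (pauli t c).
Proof.
move=> RA K0; have [c0|c0] := eqVneq c 0.
  apply: classified_representative.
  have -> : pauli t c = R1 t.
    rewrite /R1 scalemx1 /pauli big1 ?addr0 // => i _.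
    by rewrite big1 // => j _; rewrite c0 mxE scale0r.
  constructor; apply/eqP; rewrite -(@pexpr_eq1 _ _ 2) //; apply/eqP.
  have := pauli_inv_norm (pauli_unitary_inv RA).
  by rewrite c0 mul0mx mxtrace0 addr0 normCK.
have minor i j k l : c i j * c k l = c i l * c k j by apply: cofmx0_minor.
have [i ri] : exists i, row i c != 0.
  apply/existsP; apply: contraT; rewrite negb_exists => /forallP K00.
  case/negP: c0; apply/eqP/row_matrixP => i; rewrite row0.
  by apply/eqP; have := K00 i; rewrite negbK.
pose P := c *m c^t*.
have Pii : P i i != 0.
  apply: contraNneq ri => Pi0; apply/eqP; apply: sqnorm_mx_eq0.
  rewrite /mxtrace big_ord1 -[RHS]Pi0 mxE [RHS]mxE; apply: eq_bigr => k _.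
  by rewrite !mxE.
pose n : 'cV[C]_3 := col i P; pose y : 'cV[C]_3 := (P i i)^-1 *: (row i c)^T.
have nE k : n k 0 = P k i by rewrite mxE.
have yE j : y j 0 = (P i i)^-1 * c i j.
  by rewrite [y _ _]mxE [(row i c)^T _ _]mxE [row _ _ _ _]mxE.
have cE : c = n *m y^T.
  apply/matrixP => k j; rewrite mxE big_ord1 [y^T _ _]mxE nE yE.
  apply: (mulfI Pii); rewrite mulrCA mulVKf //.
  rewrite /P [(c *m _) i i]mxE [(c *m _) k i]mxE !mulr_suml.
  by apply: eq_bigr => l _; rewrite mulrAC minor; ring.
have n_neq0 : n != 0 by apply: contraNneq Pii => n0; rewrite -nE n0 mxE.
have nR : conj_mx n = n.
  apply/matrixP => k j; rewrite ord1 mxE nE /P {1}(pauli_gram_l RA) !mxE.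
  rewrite rmorph_sum; apply: eq_bigr => l _.
  by rewrite !mxE rmorphM /= conjCK.
have [u uU [h h0 un]] := rotate_to_e3 n_neq0 nR.
apply: (classified_conj uU); have := Rmatrix_conj uU RA.
rewrite local_conj_pauli //.
have -> : so3 u *m c *m (so3 u)^T = delta_mx 2%:R 0 *m (h *: (so3 u *m y))^T.
  have -> : (h *: (so3 u *m y))^T = h *: (y^T *m (so3 u)^T).
    by rewrite -trmx_mul linearZ.
  by rewrite cE mulmxA un -scalemxAr -!scalemxAl mulmxA.
move=> RA'; apply: row3_classified => //; apply: contraNneq c0 => hy.
have y0 : y = 0.
  rewrite -[y]mul1mx -(so3_orthogonal uU) -mulmxA.
  move/eqP: hy; rewrite scaler_eq0 (negPf h0) => /eqP ->.
  by rewrite mulmx0.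
by rewrite cE y0 trmx0 mulmx0.
Qed.

End RankOne.

(** * The classification *)

Section Main.
Variable C : numClosedFieldType.
Implicit Types (A B : 'M[C]_(2 * 2)) (u : 'M[C]_2).

Lemma Rmatrix_classified A : unitary_Rmatrix A -> classified A.
Proof.
move=> RA; have [/andP[sT sS]|] := boolP (is_scalar_mx (ptr2 A)
  && is_scalar_mx (ptr2 (flip A))); last exact: ptr_nonscalar_classified.
have [t [c AE]] := scalar_ptr_pauli sT sS; move: RA; rewrite {}AE => RA.
have [det0|] := eqVneq (\det c) 0; last exact: invertible_classified.
have [|K0] := eqVneq (cofmx c) 0; first exact: cofmx0_classified.
have [n [n0 nR cn]] := singular_real_kernel RA det0 K0.
have [u uU [h h0 un]] := rotate_to_e3 n0 nR.
apply: (classified_conj uU); have := Rmatrix_conj uU RA.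
rewrite local_conj_pauli // => RA'; apply: cofmx0_classified => //.
apply: kernel_e3_rank1 RA' _.
by rewrite (so3_eigen (mu := 0) uU h0 un) ?scale0r.
Qed.

Lemma norm1_conj (p : C) : `|p| = 1 -> p * p^* = 1.
Proof. by move=> p1; rewrite -normCK p1 expr1n. Qed.

Lemma mx4E (rows : seq (seq C)) (x y a b : 'I_2) :
  mx4 rows (idx x y) (idx a b)
  = nth 0 (nth [::] rows (x * 2 + y)%N) (a * 2 + b)%N.
Proof. by rewrite mxE. Qed.

Lemma mx4_unitary (rows : seq (seq C)) :
  (forall x y a b : 'I_2,
    let B := mx4 rows in
    B (idx x y) (idx 0 0) * (B (idx a b) (idx 0 0))^*
    + B (idx x y) (idx 0 1) * (B (idx a b) (idx 0 1))^*
    + (B (idx x y) (idx 1 0) * (B (idx a b) (idx 1 0))^*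
    + B (idx x y) (idx 1 1) * (B (idx a b) (idx 1 1))^*)
    = (x == a)%:R * (y == b)%:R) ->
  mx4 rows \is unitarymx.
Proof.
move=> e; apply/unitarymxP; apply: eq_tensmx => x y a b.
rewrite -tensmx11 mxtens.tensmxE [X in _ = X * _]mxE [X in _ = _ * X]mxE -e.
rewrite mxE sum_tens !sum2 /=.
by rewrite ![((mx4 rows)^t*) _ _]mxE ![(mx4 rows)^T _ _]mxE.
Qed.

Lemma Rmatrix_scale (k : C) B : `|k| = 1 ->
  unitary_Rmatrix B -> unitary_Rmatrix (k *: B).
Proof.
move=> /norm1_conj k1 [/unitarymxP BU YB]; split.
  apply/unitarymxP; rewrite linearZ map_mxZ /= -scalemxAl -scalemxAr BU.
  by rewrite scalerA k1 scale1r.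
have leg12Z : leg12 (k *: B) = k *: leg12 B.
  by apply/matrixP => i j; rewrite !mxE mulrA.
have leg23Z : leg23 (k *: B) = k *: leg23 B.
  by apply/matrixP => i j; rewrite /leg23 !(castmxE, mxE) mulrCA.
rewrite /yang_baxter leg12Z leg23Z -!(scalemxAl, scalemxAr) !scalerA.
by rewrite YB.
Qed.

Lemma representative_Rmatrix B : representative B -> unitary_Rmatrix B.
Proof.
case=> {B}[q|p q r s|p q r|q].
- move=> q1; apply: Rmatrix_scale => //; split.
    by apply/unitarymxP; rewrite adjC1 mulmx1.
  by rewrite /yang_baxter leg12_1 leg23_1.
- move=> /norm1_conj p1 /norm1_conj q1 /norm1_conj r1 /norm1_conj s1; split.
    apply: mx4_unitary => x y a b B; rewrite /B !mx4E.
    case: (ord2P x) => ->; case: (ord2P y) => ->; case: (ord2P a) => ->;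
    case: (ord2P b) => -> /=; rewrite ?(conjC0, conjC1); ring: p1 q1 r1 s1.
  apply/yang_baxterP => x y z x' y' z'; rewrite !sum2 !mx4E.
  case: (ord2P x) => ->; case: (ord2P y) => ->; case: (ord2P z) => ->;
  case: (ord2P x') => ->; case: (ord2P y') => ->; case: (ord2P z') => -> /=;
    ring.
- move=> /norm1_conj p1 /norm1_conj q1 /norm1_conj r1; split.
    apply: mx4_unitary => x y a b B; rewrite /B !mx4E.
    case: (ord2P x) => ->; case: (ord2P y) => ->; case: (ord2P a) => ->;
    case: (ord2P b) => -> /=; rewrite ?(conjC0, conjC1); ring: p1 q1 r1.
  apply/yang_baxterP => x y z x' y' z'; rewrite !sum2 !mx4E.
  case: (ord2P x) => ->; case: (ord2P y) => ->; case: (ord2P z) => ->;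
  case: (ord2P x') => ->; case: (ord2P y') => ->; case: (ord2P z') => -> /=;
    ring.
- move=> q1; pose k : C := (sqrtC 2%:R)^-1.
  have k2 : k * k + k * k = 1.
    rewrite -invfM -expr2 sqrtCK -[2%:R^-1]mul1r -splitr //.
  have kR : k^* = k.
    by apply/CrealP; rewrite realV ger0_real // sqrtC_ge0 ler0n.
  pose r4 := [:: [:: k; k; 0; 0]; [:: - k; k; 0; 0];
                 [:: 0; 0; k; - k]; [:: 0; 0; k; k]].
  have -> : R4 q = q *: mx4 r4.
    rewrite /R4 -scalerA; congr (_ *: _); apply: eq_tensmx => x y a b.
    rewrite mxE !mx4E.
    case: (ord2P x) => ->; case: (ord2P y) => ->; case: (ord2P a) => ->;
    case: (ord2P b) => -> /=; rewrite -/k; ring.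
  apply: Rmatrix_scale => //; split.
    apply: mx4_unitary => x y a b B; rewrite /B !mx4E.
    case: (ord2P x) => ->; case: (ord2P y) => ->; case: (ord2P a) => ->;
    case: (ord2P b) => -> /=; rewrite ?(conjC0, conjC1, rmorphN) /= ?kR;
    clearbody k; first
      [by ring | by transitivity (k * k + k * k); [ring | rewrite k2; ring]].
  apply/yang_baxterP => x y z x' y' z'; rewrite !sum2 !mx4E /r4.
  clearbody k.
  case: (ord2P x) => ->; case: (ord2P y) => ->; case: (ord2P z) => ->;
  case: (ord2P x') => ->; case: (ord2P y') => ->; case: (ord2P z') => -> /=;
    ring.
Qed.

Lemma Rmatrix_iff A : unitary_Rmatrix A <-> exists u B,
  [/\ u \is unitarymx, representative B & A = (u *t u) *m B *m (u *t u)^t*].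
Proof.
split=> [/Rmatrix_classified // | [u [B [uU /representative_Rmatrix RB ->]]]].
exact: Rmatrix_conj.
Qed.

End Main.

Unset Implicit Arguments.

Theorem theorem8p1 (K : realType) (A : 'M[K[i]]_(2 * 2)) :
  unitary_Rmatrix A <->
  exists (u : 'M[K[i]]_2) (B : 'M[K[i]]_(2 * 2)),
    [/\ u \is unitarymx,
        representative B
      & A = (u *t u) *m B *m (u *t u)^t*].
Proof. exact: Rmatrix_iff. Qed.
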